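(* There exist absolute constants $c, C > 0$ such that the following holds. Let $X,Y,Z$ be finite nonempty sets, $\Omega = X\times Y\times Z$, and let $f(x,y), g(x,z), h(y,z)$ be indicator functions on $\Omega$. Consider the cylinder intersection $F(x,y,z) = f(x,y)g(x,z)h(y,z)$. Let $d\ge 5$ and suppose $\mathbb{E}_{(x,y,z)\sim\Omega}[F(x,y,z)] \le 2^{-d}$. Then there exist slice functions $s_1,\dots,s_R$ and coefficients $c_1,\dots,c_R \ge 0$ such that $$F(x,y,z) \le \sum_{i=1}^R c_i s_i(x,y,z) \quad\text{for all }(x,y,z)\in\Omega,$$ where each $s_i$ satisfies $\mathbb{E}_\Omega[s_i] \ge 2^{-Cd}$, and $$\mathbb{E}_{(x,y,z)\sim\Omega}\left[\sum_{i=1}^R c_i s_i(x,y,z)\right] \le 2^{-c d^{1/2}}.$$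
   Context: A slice function on $\Omega = X\times Y\times Z$ is an indicator function of one of the forms $g(x,y)h(z)$, $g(x)h(y,z)$, or $g(x,z)h(y)$, with $g,h$ $\{0,1\}$-valued. Expectations over $\Omega$ are uniform. *)

(* Defs.v *)
From mathcomp Require Export all_boot all_order all_algebra.
From mathcomp Require Export reals exp.

Set Implicit Arguments.
Unset Strict Implicit.
Unset Printing Implicit Defensive.

Import GRing.Theory Num.Theory.
Local Open Scope ring_scope.

Definition expectation (R : realType) (T : finType) (F : T -> R) : R :=
  (\sum_(w : T) F w) / #|T|%:R.

(* A {0,1}-valued function is given by a boolean predicate, read as a
   real-valued function through the cast b%:R. *)

Definition cylinder_intersection (R : realType) (X Y Z : finType)
    (f : X -> Y -> bool) (g : X -> Z -> bool) (h : Y -> Z -> bool)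
    (w : X * Y * Z) : R :=
  let: (x, y, z) := w in (f x y)%:R * (g x z)%:R * (h y z)%:R.

Definition slice_function (R : realType) (X Y Z : finType)
    (s : X * Y * Z -> R) : Prop :=
  [\/ exists (g : X -> Y -> bool) (h : Z -> bool),
        forall x y z, s (x, y, z) = (g x y)%:R * (h z)%:R,
      exists (g : X -> bool) (h : Y -> Z -> bool),
        forall x y z, s (x, y, z) = (g x)%:R * (h y z)%:R
    | exists (g : X -> Z -> bool) (h : Y -> bool),
        forall x y z, s (x, y, z) = (g x z)%:R * (h y)%:R].

(* Main.v *)
(** By multiplicative weights (a constructive form of LP duality) it suffices to show
the dual statement: if a probability measure [nu] supported on [F] gives every not too
small slice mass at most [K] times its uniform measure, with [K = 2 ^ O(sqrt d)], then
[F] has density more than [2 ^ (- d)].  Choose a box [A x B x C] maximizing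
[nu(box) ^ n / |box| ^ (n - 1)] (with sizes padded by a tiny amount).  Inside the box,
the densities of the two-dimensional marginals of [nu] are essentially bounded by [4 K],
have almost constant degrees, and no rectangle carries much more than its share of mass.
Let [f', g', h'] be these densities, truncated.  If the triangle density
[E f' g' h'] were less than 1/4, then [E_z g'(x,z) h'(y,z)] would be at most 1/2 for a
[1 / O(K)] fraction of pairs; a high even moment of [E_z (g'-1)(h'-1)] decouples into
the corresponding moments for [g'] or [h'] alone, and positivity of these moments
yields a vertex [x] whose neighbourhood [g'(x,.)] is positively correlated with those
of many [x'].  This produces a rectangle that is too heavy.  Hence [E f' g' h'] is at
least 1/4, and [F], which contains the support of [f' g' h'], is dense in the box. *)

Require Import Defs.
From mathcomp Require Import all_boot all_order all_algebra.
From mathcomp Require Import reals sequences exp boolp.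
From mathcomp Require Import lra ring zify.

Set Implicit Arguments.
Unset Strict Implicit.
Unset Printing Implicit Defensive.

Import Order.TTheory GRing.Theory Num.Theory.
Local Open Scope ring_scope.

(** The square root comes from balancing [K], of order 2^p, against the exponent [n]. A deficient
    triangle count is visible only on a fraction of about 1/K of the pairs; a moment of order [p]
    turns this loss into a constant factor per power, 2^(-p) 3^(-p) = 6^(-p), which positivity of
    kernels can still exploit. It yields a rectangle with excess factor [tau] and one side of
    density at least tau^(-O(p)). Extremality excludes such a rectangle only if [n] is a large
    multiple of [p]. The maximal box may then be as small as K^(-n) = 2^(-O(p^2)), so [p] has to be
    of order sqrt d. The padding is needed because the dual hypothesis only concerns slices of
    density at least 2^(-O(d)). Adding a tiny [r0] to every size extends the mass bound to all
    slices and keeps the maximized ratio defined on empty boxes. Relative to the box the padding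
    becomes [rho], which must stay far below the density of the heavy rectangle; its exponent of
    order p^2 is still affordable. *)

Section Averages.
Context {R : realType}.

(** * Weighted averages and positivity of powers of Gram kernels *)

Definition avg (T : finType) (p phi : T -> R) : R := \sum_t p t * phi t.

Definition prob_weight (T : finType) (p : T -> R) : Prop :=
  (forall t, 0 <= p t) /\ \sum_t p t = 1.

Lemma le_avg (T : finType) (p phi psi : T -> R) : (forall t, 0 <= p t) ->
  (forall t, phi t <= psi t) -> avg p phi <= avg p psi.
Proof. by move=> p0 le; apply: ler_sum => t _; apply: ler_wpM2l. Qed.

Lemma eq_avg (T : finType) (p phi psi : T -> R) :
  phi =1 psi -> avg p phi = avg p psi.
Proof. by move=> e; apply: eq_bigr => t _; rewrite e. Qed.

Lemma avg_ge0 (T : finType) (p phi : T -> R) : (forall t, 0 <= p t) ->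
  (forall t, 0 <= phi t) -> 0 <= avg p phi.
Proof. by move=> p0 le; apply: sumr_ge0 => t _; apply: mulr_ge0. Qed.

Lemma avgD (T : finType) (p phi psi : T -> R) :
  avg p (fun t => phi t + psi t) = avg p phi + avg p psi.
Proof. by rewrite /avg -big_split; apply: eq_bigr => t _; rewrite mulrDr. Qed.

Lemma avgN (T : finType) (p phi : T -> R) :
  avg p (fun t => - phi t) = - avg p phi.
Proof. by rewrite /avg -sumrN; apply: eq_bigr => t _; rewrite mulrN. Qed.

Lemma avgB (T : finType) (p phi psi : T -> R) :
  avg p (fun t => phi t - psi t) = avg p phi - avg p psi.
Proof. by rewrite avgD avgN. Qed.

Lemma avgZ (T : finType) (p phi : T -> R) (a : R) :
  avg p (fun t => a * phi t) = a * avg p phi.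
Proof. by rewrite /avg mulr_sumr; apply: eq_bigr => t _; rewrite mulrCA. Qed.

Lemma avgZr (T : finType) (p phi : T -> R) (a : R) :
  avg p (fun t => phi t * a) = avg p phi * a.
Proof. by rewrite mulrC -avgZ; apply: eq_avg => t; rewrite mulrC. Qed.

Lemma avg_cst (T : finType) (p : T -> R) (a : R) : prob_weight p ->
  avg p (fun=> a) = a.
Proof. by case=> _ p1; rewrite /avg -mulr_suml p1 mul1r. Qed.

Lemma avg_exchange (T U : finType) (p : T -> R) (q : U -> R) (phi : T -> U -> R) :
  avg p (fun t => avg q (phi t)) = avg q (fun u => avg p (phi^~ u)).
Proof.
under eq_avg do rewrite /avg.
rewrite /avg; under eq_bigr do rewrite mulr_sumr.
rewrite exchange_big; apply: eq_bigr => u _; rewrite mulr_sumr.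
by apply: eq_bigr => t _; rewrite mulrCA.
Qed.

(** The total weight may be below 1, since this is applied to weights restricted to good vertices;
    [0 < a] keeps the pigeonhole valid in that case. *)
Lemma exists_ge_avg (T : finType) (p phi : T -> R) (a : R) :
  (forall t, 0 <= p t) -> \sum_t p t <= 1 -> 0 < a -> a <= avg p phi ->
  exists2 t, 0 < p t & a <= phi t.
Proof.
move=> p0 p1 a0 le.
have [|no] := pselect (exists2 t, 0 < p t & a <= phi t); first by [].
have lt t : 0 < p t -> phi t < a.
  by move=> pt; rewrite ltNge; apply/negP => H; apply: no; exists t.
have le' t : p t * phi t <= p t * a.
  have := p0 t; rewrite le_eqVlt => /predU1P[<-|pt]; first by rewrite !mul0r.
  by rewrite ler_pM2l // ltW // lt.
have [/existsP[t pt]|] := boolP [exists t, 0 < p t].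
  have : avg p phi < \sum_t p t * a.
    rewrite /avg (bigD1 t) //= [ltRHS](bigD1 t) //=.
    by rewrite ltr_leD ?ltr_pM2l ?lt // ler_sum.
  rewrite -mulr_suml => H; have := le_lt_trans le H.
  by rewrite ltNge => /negP[]; rewrite -[leRHS]mul1r ler_wpM2r // ltW.
rewrite negb_exists => /forallP p00.
have : avg p phi = 0.
  apply: big1 => t _; have := p00 t; rewrite -leNgt => h.
  by rewrite (_ : p t = 0) ?mul0r //; apply/eqP; rewrite eq_le h p0.
by move=> e; move: le; rewrite e leNgt a0.
Qed.

Lemma bernoulli (x : R) (k : nat) : 0 <= x -> 1 + k%:R * x <= (1 + x) ^+ k.
Proof.
move=> x0; elim: k => [|k IH]; first by rewrite mul0r addr0 expr0.
rewrite exprS -natr1; have k0 : 0 <= k%:R * x by rewrite mulr_ge0.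
have : (1 + x) * (1 + k%:R * x) <= (1 + x) * (1 + x) ^+ k.
  by rewrite ler_wpM2l // addr_ge0.
apply: le_trans; have : 0 <= x * (k%:R * x) by rewrite mulr_ge0.
by lra.
Qed.

(** Schur's product theorem for powers of a Gram kernel. One factor of the power is expanded as an
    average over [z], and for each [z] the values [a t z], [a t' z] are absorbed into the
    coefficients; at exponent 0 the form is a square. *)
Lemma kernel_power_ge0 (T Z : finType) (pZ : Z -> R) (a : T -> Z -> R)
    (c : T -> R) (j : nat) : (forall z, 0 <= pZ z) ->
  0 <= \sum_t \sum_t' c t * c t' * avg pZ (fun z => a t z * a t' z) ^+ j.
Proof.
move=> p0; elim: j c => [|j IH] c.
  under eq_bigr do under eq_bigr do rewrite expr0 mulr1.
  under eq_bigr do rewrite -mulr_sumr.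
  by rewrite -mulr_suml -expr2 sqr_ge0.
have -> : \sum_t \sum_t' c t * c t' * avg pZ (fun z => a t z * a t' z) ^+ j.+1
  = \sum_z pZ z * \sum_t \sum_t' (c t * a t z) * (c t' * a t' z)
      * avg pZ (fun z => a t z * a t' z) ^+ j.
  under [RHS]eq_bigr do (rewrite mulr_sumr;
    under eq_bigr do rewrite mulr_sumr).
  rewrite [RHS]exchange_big; apply: eq_bigr => t _ /=.
  rewrite [RHS]exchange_big; apply: eq_bigr => t' _ /=.
  rewrite exprS {1}/avg mulrA mulr_sumr mulr_suml; apply: eq_bigr => z _.
  by ring.
by apply: sumr_ge0 => z _; rewrite mulr_ge0.
Qed.

(** Positivity on the disjoint union [X + Y], with coefficients [c] on [X] and [- e] on [Y], so that
    the mixed terms appear with a minus sign. *)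
Lemma kernel_power_cross (X Y Z : finType) (pZ : Z -> R) (a : X -> Z -> R)
    (b : Y -> Z -> R) (c : X -> R) (e : Y -> R) (j : nat) :
  (forall z, 0 <= pZ z) ->
  2 * \sum_x \sum_y c x * e y * avg pZ (fun z => a x z * b y z) ^+ j <=
    \sum_x \sum_x' c x * c x' * avg pZ (fun z => a x z * a x' z) ^+ j +
    \sum_y \sum_y' e y * e y' * avg pZ (fun z => b y z * b y' z) ^+ j.
Proof.
move=> p0; pose ab (t : X + Y) := match t with inl x => a x | inr y => b y end.
pose ce (t : X + Y) := match t with inl x => c x | inr y => - e y end.
have := @kernel_power_ge0 _ _ pZ ab ce j p0.
rewrite big_sumType /=.
under eq_bigr do rewrite big_sumType /=.
under [X in _ <= _ + X]eq_bigr do rewrite big_sumType /=.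
rewrite !big_split /=.
set S1 := (X in _ <= X + _ + _); set S2 := (X in _ <= _ + X + _).
set S3 := (X in _ <= _ + _ + (X + _)); set S4 := (X in _ <= _ + _ + (_ + X)).
set D := (X in 2 * X).
have -> : S2 = - D.
  rewrite /S2 /D -sumrN; apply: eq_bigr => x _; rewrite -sumrN.
  by apply: eq_bigr => y _; ring.
have -> : S3 = - D.
  rewrite /S3 /D exchange_big -sumrN; apply: eq_bigr => x _; rewrite -sumrN.
  apply: eq_bigr => y _ /=.
  rewrite (_ : avg pZ _ = avg pZ (fun z => a x z * b y z)); first by ring.
  by apply: eq_avg => z; rewrite mulrC.
have -> : S4 = \sum_y \sum_y' e y * e y' * avg pZ (fun z => b y z * b y' z) ^+ j.
  by apply: eq_bigr => y _; apply: eq_bigr => y' _; rewrite mulrNN.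
have -> : S1 = \sum_x \sum_x' c x * c x' * avg pZ (fun z => a x z * a x' z) ^+ j.
  by [].
lra.
Qed.

(** For k > 0, the binomial coefficient of (k p, p) is k times that of (k p - 1, p - 1), and k p - 1
    >= k (p - 1). *)
Lemma leq_expn_bin (k p r : nat) : (k * p <= r)%N -> (k ^ p <= 'C(r, p))%N.
Proof.
move=> le; apply: leq_trans (leq_bin2l p le); elim: p {r le} => [|p IH].
  by rewrite bin0.
case: k IH => [|k] IH; first by rewrite exp0n.
rewrite -(leq_pmul2l (ltn0Sn p)).
have -> : (k.+1 * p.+1 = (k.+1 * p + k).+1)%N by lia.
rewrite -mul_bin_diag.
have -> : ((k.+1 * p + k).+1 = p.+1 * k.+1)%N by lia.
rewrite expnS mulnA leq_mul //; apply: leq_trans IH _.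
by apply: leq_bin2l; lia.
Qed.

(** All terms of the binomial expansion are nonnegative by [kernel_power_ge0], so a single one
    bounds the sum from below. This amplifies a small [p]-th moment of the kernel into a large
    [q]-th moment of 1 plus the kernel. *)
Lemma kernel_power_binomial (T Z : finType) (pZ : Z -> R) (a : T -> Z -> R)
    (c : T -> R) (p q : nat) : (forall z, 0 <= pZ z) -> (p <= q)%N ->
  'C(q, p)%:R * \sum_t \sum_t' c t * c t' * avg pZ (fun z => a t z * a t' z) ^+ p
  <= \sum_t \sum_t' c t * c t' * (1 + avg pZ (fun z => a t z * a t' z)) ^+ q.
Proof.
move=> p0 lepq.
have -> : \sum_t \sum_t' c t * c t' * (1 + avg pZ (fun z => a t z * a t' z)) ^+ q
  = \sum_(j < q.+1) 'C(q, j)%:R *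
      \sum_t \sum_t' c t * c t' * avg pZ (fun z => a t z * a t' z) ^+ j.
  under [RHS]eq_bigr do (rewrite mulr_sumr;
    under eq_bigr do rewrite mulr_sumr).
  rewrite [RHS]exchange_big; apply: eq_bigr => t _ /=.
  rewrite [RHS]exchange_big; apply: eq_bigr => t' _ /=.
  rewrite exprDn mulr_sumr; apply: eq_bigr => j _.
  by rewrite expr1n mul1r -mulr_natl; ring.
rewrite (bigD1 (Ordinal (lepq : p < q.+1)%N)) //= lerDl.
by apply: sumr_ge0 => j _; rewrite mulr_ge0 ?kernel_power_ge0.
Qed.
End Averages.

(** * Truncation of an almost bounded density *)

Section Truncation.
Context {R : realType}.
Variables (X Z : finType) (pX : X -> R) (pZ : Z -> R) (g : X -> Z -> R).
Variables (K rho : R).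
Hypotheses (pXP : prob_weight pX) (pZP : prob_weight pZ).
Hypotheses (g0 : forall x z, 0 <= g x z) (K0 : 0 < K).

Definition truncate (L : R) (x : X) (z : Z) : R := Num.min (g x z) L.

(** Almost the pointwise bound [g <= K]: the slack [rho] tolerates huge values on a tiny set, which
    truncation removes. *)
Definition spread : Prop := forall P : X -> Z -> bool,
  avg pX (fun x => avg pZ (fun z => g x z * (P x z)%:R)) <=
  K * (avg pX (fun x => avg pZ (fun z => (P x z)%:R)) + rho).

Let pX0 := pXP.1.
Let pZ0 := pZP.1.

Lemma truncate_ge0 x z : 0 <= truncate (2 * K) x z.
Proof. by rewrite /truncate le_min g0 mulr_ge0 // ltW. Qed.

Lemma truncate_le x z : truncate (2 * K) x z <= 2 * K.
Proof. by rewrite /truncate ge_min lexx orbT. Qed.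

Lemma truncate_le_id x z : truncate (2 * K) x z <= g x z.
Proof. by rewrite /truncate ge_min lexx. Qed.

(** The set where g > 2K, of measure [b] and mass [a], satisfies 2K b <= a <= K (b + rho); hence b
    <= rho and a <= 2K rho. *)
Lemma truncation_loss : spread ->
  avg pX (fun x => avg pZ (fun z => g x z - truncate (2 * K) x z)) <=
  2 * K * rho.
Proof.
move=> S; pose P x z := (2 * K < g x z).
have := S P; set a := avg pX _; set b := avg pX _ => le_ab.
have le1 : avg pX (fun x => avg pZ (fun z => g x z - truncate (2 * K) x z)) <= a.
  apply: le_avg => // x; apply: le_avg => // z; rewrite /truncate /P minEle.
  by case: leP => h; rewrite ?subrr ?mulr1 ?mulr0 // gerBl mulr_ge0 // ltW.
have le2 : 2 * K * b <= a.
  rewrite -avgZ; apply: le_avg => // x; rewrite -avgZ; apply: le_avg => // z.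
  by rewrite /P; case: ltP => h; rewrite ?mulr1 ?mulr0 // ltW.
lra.
Qed.
End Truncation.

(** * Degrees in an extremal density *)

Section Degrees.
Context {R : realType}.
Variables (X : finType) (pX : X -> R) (d : X -> R) (rho : R) (n : nat).
Hypotheses (pXP : prob_weight pX) (d1 : avg pX d = 1).
Hypothesis rho0 : 0 <= rho.

(* Extremality of the whole space for [nu A ^ n / |A| ^ (n - 1)], with each size
   padded by [rho]. *)
Definition extremal : Prop := forall A : X -> bool,
  avg pX (fun x => d x * (A x)%:R) ^+ n <=
  ((avg pX (fun x => (A x)%:R) + rho) / (1 + rho)) ^+ n.-1.

Let pX0 := pXP.1.

(** Deleting the vertices of low degree loses less than their share of mass, and for n (theta - rho)
    > 1 the [n]-th power outweighs the lost volume. Hence low degrees are excluded altogether,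
    whereas high degrees are only rare. *)
Lemma no_low_degree (theta : R) : extremal -> 0 < rho -> theta <= 1 ->
  1 < n%:R * (theta - rho) -> avg pX (fun x => (d x < 1 - theta)%R%:R) = 0.
Proof.
move=> E rho_gt0 th1 nth; set m := avg pX _.
have m0 : 0 <= m by apply: avg_ge0.
apply/eqP; rewrite eq_le m0 andbT leNgt; apply/negP => m_gt0.
have m1 : m <= 1.
  rewrite -[leRHS](avg_cst 1 pXP); apply: le_avg => // x.
  by case: (_ < _).
have := E (fun x => ~~ (d x < 1 - theta)).
set nu := avg pX _; set a := avg pX _.
have ea : a = 1 - m.
  rewrite -{1}(avg_cst 1 pXP) -avgB; apply: eq_avg => x.
  by case: (_ < _); rewrite ?subrr ?subr0.
have nuE : 1 - (1 - theta) * m <= nu.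
  rewrite -{1}d1 -avgZ -avgB; apply: le_avg => // x.
  by case: ltP => h /=; lra.
rewrite ea; set y := _ / _ => nuy.
set m' := m / (1 + rho).
have rho1 : 0 < 1 + rho by lra.
have m'0 : 0 < m' by rewrite divr_gt0.
have mE : m = m' * (1 + rho) by rewrite /m' divfK // gt_eqF.
have yE : y = 1 - m'.
  rewrite /y mE; field; by rewrite gt_eqF.
have y0 : 0 < y by rewrite /y divr_gt0 //; lra.
have th_rho : 0 < theta - rho.
  rewrite ltNge; apply/negP => H.
  have := mulr_ge0_le0 (ler0n R n) H; lra.
(* Chosen so that y (1 + x) = 1 - m' + (theta - rho) m' is a lower bound for the remaining mass.
   Extremality then gives y (1 + x)^n <= 1, while Bernoulli gives y (1 + n x) > y + m' = 1. *)
pose x := m' * (theta - rho) / y.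
have x0 : 0 <= x by apply/ltW/divr_gt0 => //; apply: mulr_gt0.
have le_nu : y * (1 + x) <= nu.
  apply: le_trans nuE.
  rewrite mulrDr mulr1 /x mulrCA divff ?gt_eqF // mulr1 yE mE.
  have : 0 <= m' * (theta * rho).
    by apply: mulr_ge0; [exact: ltW | apply: mulr_ge0; lra].
  lra.
have n0 : (0 < n)%N.
  by case: (n) nth => //; rewrite mul0r => ?; exfalso; lra.
have : y ^+ n * (1 + x) ^+ n <= y ^+ n.-1.
  rewrite -exprMn; apply: le_trans nuy.
  have yx0 : 0 <= y * (1 + x) by apply: mulr_ge0; [exact: ltW | lra].
  rewrite lerXn2r // ?nnegrE.
  by apply: le_trans le_nu.
rewrite -(prednK n0) /= exprSr -mulrA ger_pMr ?exprn_gt0 // prednK //.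
apply/negP; rewrite -ltNge.
apply: (lt_le_trans _ (ler_wpM2l (ltW y0) (bernoulli n x0))).
have -> : y * (1 + n%:R * x) = y + n%:R * (theta - rho) * m'.
  by rewrite /x; field; rewrite gt_eqF.
have : m' < n%:R * (theta - rho) * m' by rewrite ltr_pMl.
lra.
Qed.

(** The high-degree set has mass at least (1 + theta) m and padded size at most (1 + theta/10) m, so
    extremality makes [m] exponentially small in [n]. The 89/100 comes from (1 + 0.89 theta)(1 +
    theta/10) <= 1 + theta for theta <= 1/10. *)
Lemma few_high_degree (theta m : R) :
  avg pX (fun x => (1 + theta < d x)%R%:R) = m ->
  extremal -> 0 <= theta -> 10 * theta <= 1 -> rho <= theta / 10 * m ->
  (1 + 89 / 100 * theta) ^+ n * m <= 1.
Proof.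
move=> Em E th0 th1 rhom.
have rho_ge0 := rho0; have rho1 : 0 < 1 + rho by lra.
have m0 : 0 <= m by rewrite -Em; apply: avg_ge0.
have := E (fun x => 1 + theta < d x); rewrite Em.
set nu := avg pX _; set y := (m + rho) / _ => nuy.
have mnu : (1 + theta) * m <= nu.
  rewrite -Em -avgZ; apply: le_avg => // x; case: ltP => h /=; lra.
have [m00|m_gt0] := leP m 0.
  by rewrite (_ : m = 0) ?mulr0 ?ler01 //; lra.
have yle : y <= m * (1 + theta / 10).
  rewrite /y ler_pdivrMr //.
  have h : 0 <= m * (1 + theta / 10) * rho by rewrite !mulr_ge0 //; lra.
  lra.
have y0 : 0 <= y by apply: divr_ge0; lra.
case: n nuy => [|k] nuy /=.
  rewrite expr0 mul1r -[leRHS](avg_cst 1 pXP) -Em; apply: le_avg => // x.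
  by case: (_ < _).
have le1 : ((1 + theta) * m) ^+ k.+1 <= (m * (1 + theta / 10)) ^+ k.
  apply: le_trans (le_trans nuy _); last by rewrite lerXn2r // nnegrE; lra.
  rewrite lerXn2r // nnegrE; first by rewrite mulr_ge0 //; lra.
  by apply: le_trans mnu; rewrite mulr_ge0 //; lra.
have le2 : (m * (1 + theta / 10)) ^+ k <= m ^+ k * (1 + theta / 10) ^+ k.+1.
  rewrite exprMn ler_wpM2l ?exprn_ge0 // exprS ler_peMl ?exprn_ge0 //; lra.
have le3 : ((1 + 89 / 100 * theta) * (1 + theta / 10)) ^+ k.+1 * m ^+ k.+1 <=
   ((1 + theta) * m) ^+ k.+1.
  rewrite -exprMn lerXn2r ?nnegrE //.
  - by rewrite !mulr_ge0 //; lra.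
  - by rewrite !mulr_ge0 //; lra.
  - rewrite ler_wpM2r //; have := mulr_ge0 th0 th0.
    have : theta * theta <= 10^-1 * theta by rewrite ler_wpM2r //; lra.
    lra.
have := le_trans le3 (le_trans le1 le2).
rewrite exprMn [m ^+ k.+1]exprS.
have -> : forall a b c e : R, a * b * (c * e) = (a * c) * (e * b).
  by move=> *; ring.
rewrite -[leRHS]mul1r ler_pM2r // mulr_gt0 ?exprn_gt0 //; lra.
Qed.
End Degrees.

(** Pigeonhole over geometric levels. Below level k + 2 one has W^q <= t^(q (k + 2)) <= t^(2 q (k +
    1)); if level k + 1 always had weight below t^(-23 q (k + 1)), it would contribute at most
    t^(-21 q (k + 1)) <= 2^(-(k + 1)), and all levels together at most 1. The bound t^N makes the
    number of levels finite. *)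
Lemma level_set {R : realType} (T : finType) (c W : T -> R) (t : R) (q N : nat) :
  (forall x, 0 <= c x) -> \sum_x c x <= 1 -> (forall x, 0 <= W x) -> 1 <= t ->
  (0 < q)%N -> 2 <= t ^+ (21 * q) -> (forall x, W x < t ^+ N) ->
  t ^+ q + 1 < avg c (fun x => W x ^+ q) ->
  exists2 k : nat, (0 < k)%N &
    (t ^+ (23 * q * k))^-1 <= avg c (fun x => (t ^+ k <= W x)%R%:R).
Proof.
move=> c0 c1 W0 t1 q0 t2 WN big_avg.
pose u k := avg c (fun x => (t ^+ k <= W x)%R%:R).
have [|no] := pselect (exists2 k : nat, (0 < k)%N & (t ^+ (23 * q * k))^-1 <= u k).
  by [].
exfalso; have t0 : 0 < t by lra.
have ptw N' x : W x < t ^+ N'.+1 -> W x ^+ q <=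
    t ^+ q + \sum_(k < N') t ^+ (q * k.+2) * (t ^+ k.+1 <= W x)%R%:R.
  elim: N' => [|N' IH] lt.
    rewrite big_ord0 addr0 lerXn2r ?nnegrE // ltW //.
  rewrite big_ord_recr /=.
  have [lt'|ge'] := ltP (W x) (t ^+ N'.+1).
    by rewrite mulr0 addr0 IH.
  rewrite mulr1 addrA; apply: (@le_trans _ _ (t ^+ (q * N'.+2))).
    by rewrite mulnC exprM lerXn2r // ?nnegrE ?exprn_ge0 // ltW.
  rewrite lerDr; apply: addr_ge0; first exact/exprn_ge0/ltW.
  by apply: sumr_ge0 => i _; rewrite mulr_ge0 ?ler0n ?exprn_ge0 ?ltW.
have geom : forall M, \sum_(k < M) (2^-1 : R) ^+ k.+1 = 1 - 2^-1 ^+ M.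
  elim=> [|M IH]; first by rewrite big_ord0 expr0 subrr.
  rewrite big_ord_recr /= IH exprS; lra.
have : avg c (fun x => W x ^+ q) <= t ^+ q + 1; last by lra.
apply: (@le_trans _ _ (avg c (fun x => t ^+ q +
    \sum_(k < N) t ^+ (q * k.+2) * (t ^+ k.+1 <= W x)%R%:R))).
  apply: le_avg => // x; apply: ptw; apply: lt_le_trans (WN x) _.
  by rewrite ler_weXn2l.
rewrite avgD lerD //.
  rewrite /avg -mulr_suml ger_pMl ?exprn_gt0 //.
rewrite {1}/avg; under eq_bigr do rewrite mulr_sumr.
rewrite exchange_big /=.
apply: (@le_trans _ _ (\sum_(k < N) (2^-1 : R) ^+ k.+1)); last first.
  by rewrite geom gerBl exprn_ge0 // invr_ge0.
apply: ler_sum => k _.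
have -> : \sum_x c x * (t ^+ (q * k.+2) * (t ^+ k.+1 <= W x)%R%:R)
   = t ^+ (q * k.+2) * u k.+1 by rewrite /u -avgZ.
have uk : u k.+1 <= (t ^+ (23 * q * k.+1))^-1.
  rewrite leNgt; apply/negP => H; apply: no; exists k.+1 => //; exact: ltW.
apply: (le_trans (ler_wpM2l _ uk)); first by rewrite exprn_ge0 // ltW.
rewrite ler_pdivrMr ?exprn_gt0 //.
have : t ^+ (q * k.+2) <= t ^+ (2 * q * k.+1) by rewrite ler_weXn2l //; nia.
move/le_trans; apply.
have -> : (23 * q * k.+1 = 21 * q * k.+1 + 2 * q * k.+1)%N by lia.
rewrite exprD mulrA ler_peMl //; first exact/exprn_ge0/ltW.
rewrite exprM -exprMn; apply: exprn_ege1; lra.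
Qed.

(** * Rectangles in an extremal density *)

Section Rectangles.
Context {R : realType}.
Variables (X Z : finType) (pX : X -> R) (pZ : Z -> R) (g : X -> Z -> R).
Variables (rho : R) (n : nat).
Hypotheses (pXP : prob_weight pX) (pZP : prob_weight pZ).
Hypotheses (g0 : forall x z, 0 <= g x z) (rho0 : 0 <= rho).

Definition rect_extremal : Prop := forall (A : X -> bool) (C : Z -> bool),
  avg pX (fun x => avg pZ (fun z => g x z * ((A x)%:R * (C z)%:R))) ^+ n <=
  ((avg pX (fun x => (A x)%:R) + rho) * (avg pZ (fun z => (C z)%:R) + rho))
    ^+ n.-1.

Let pX0 := pXP.1.
Let pZ0 := pZP.1.

(** Makes the extremal inequality linear in [y], at the price of a factor [s] and a small additive
    error. If s^n y >= 1 then y^(n-1) <= (s y)^n; otherwise y < s^(-n), and y^(n-1) <= s^(-n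
    (n-1)). *)
Lemma le_of_expr_pred (nu y s : R) : (0 < n)%N -> 0 <= nu -> 0 <= y -> 0 < s ->
  nu ^+ n <= y ^+ n.-1 -> nu <= s * y + (s ^+ n.-1)^-1.
Proof.
case: n => // k _ nu0 y0 s0 /= H.
have sk0 : 0 < s ^+ k by rewrite exprn_gt0.
have sy0 : 0 <= s * y by rewrite mulr_ge0 // ltW.
have [h|h] := leP 1 (s ^+ k.+1 * y).
  suff : nu <= s * y by move=> h'; rewrite (le_trans h') // lerDl invr_ge0 ltW.
  rewrite -(@ler_pXn2r _ k.+1) // ?nnegrE //; apply: le_trans H _.
  by rewrite exprMn [y ^+ k.+1]exprS mulrA ler_peMl ?exprn_ge0.
suff : nu <= (s ^+ k)^-1 by move=> h'; rewrite (le_trans h') // lerDr.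
have ik0 : 0 <= (s ^+ k)^-1 by rewrite invr_ge0 ltW.
rewrite -(@ler_pXn2r _ k.+1) // ?nnegrE //.
apply: le_trans H _; rewrite exprVn -exprM mulnC exprM -exprVn.
have iS0 : 0 <= (s ^+ k.+1)^-1 by rewrite invr_ge0 exprn_ge0 // ltW.
rewrite lerXn2r ?nnegrE //.
by rewrite -div1r ler_pdivlMr ?exprn_gt0 // mulrC ltW.
Qed.

(* Only the part of [z |-> avg_A g(., z)] above the threshold [s * (|A| + rho)]
   is charged to a rectangle. *)
Lemma correlation_le (A : X -> bool) (phi : Z -> R) (L s u : R) :
  rect_extremal -> (0 < n)%N -> 0 < s -> 0 <= L -> (forall z, 0 <= phi z <= L) ->
  avg pX (fun x => (A x)%:R) = u ->
  avg pZ (fun z => phi z * avg pX (fun x => g x z * (A x)%:R)) <=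
  s * (u + rho) * avg pZ phi +
    L * (s * (u + rho) * rho + (s ^+ n.-1)^-1).
Proof.
move=> E n0 s0 L0 phiP uE.
pose e z := avg pX (fun x => g x z * (A x)%:R); pose b := s * (u + rho).
have u0 : 0 <= u by rewrite -uE; apply: avg_ge0.
have b0 : 0 <= b by apply: mulr_ge0; [exact: ltW | exact: addr_ge0].
pose C z := b < e z; pose v := avg pZ (fun z => (C z)%:R).
have v0 : 0 <= v by apply: avg_ge0.
have := E A C; rewrite uE -/v.
have -> : avg pX (fun x => avg pZ (fun z => g x z * ((A x)%:R * (C z)%:R))) =
    avg pZ (fun z => e z * (C z)%:R).
  rewrite avg_exchange; apply: eq_avg => z; rewrite /e -avgZr.
  by apply: eq_avg => x; rewrite mulrA.
set nu := avg pZ _ => H.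
have nu0 : 0 <= nu.
  by apply: avg_ge0 => // z; rewrite mulr_ge0 //; apply: avg_ge0 => // x; rewrite mulr_ge0.
have nuS : nu <= b * (v + rho) + (s ^+ n.-1)^-1.
  by rewrite /b -mulrA; apply: le_of_expr_pred; rewrite // ?mulr_ge0 ?addr_ge0.
have : avg pZ (fun z => phi z * e z) <= b * avg pZ phi + L * (nu - b * v).
  rewrite -!avgZ -avgB -avgZ -avgD; apply: le_avg => // z.
  have /andP[h1 h2] := phiP z.
  rewrite /C; case: ltP => h /=; last first.
    by rewrite !mulr0 subr0 mulr0 addr0 mulrC ler_wpM2r.
  have : 0 <= (L - phi z) * (e z - b) by rewrite mulr_ge0 // subr_ge0 // ltW.
  lra.
move/le_trans; apply; rewrite lerD2l ler_wpM2l //; rewrite -/b; lra.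
Qed.
End Rectangles.

(** * Numerical inequalities behind the choice of constants *)

Section Numerics.
Context {R : realType}.

Lemma expr_mul_ge_bernoulli (x : R) (k m : nat) (y : R) : 0 <= x -> y <= 1 + k%:R * x ->
  0 <= y -> y ^+ m <= (1 + x) ^+ (k * m).
Proof.
move=> x0 yx y0; rewrite exprM lerXn2r ?nnegrE ?exprn_ge0 //; first by lra.
exact: le_trans yx (bernoulli k x0).
Qed.

Lemma expr2_ge (m : nat) : m%:R + 1 <= (2 : R) ^+ m.
Proof. have := @bernoulli R 1 m ler01; rewrite mulr1; lra. Qed.

Lemma expr2_ge_24 (p : nat) : (24 <= p)%N -> 1000 * 1000 <= (2 : R) ^+ p.
Proof.
move=> p24; apply: (@le_trans _ _ (2 ^+ 24)); last by rewrite ler_weXn2l //; lra.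
rewrite !exprS expr0; lra.
Qed.

(** Explains q = 13 p + 1: 13 is large enough that 13^p 6^(-p) >= 2^p, and small enough that
    (31/30)^13 <= 1.6, so that 2^p exceeds the threshold of [level_set]. *)
Lemma level_start_lt (p : nat) : (24 <= p)%N ->
  (31 / 30 : R) ^+ (13 * p + 1) + 1 < 2 ^+ p.
Proof.
move=> p24; rewrite exprD exprM expr1.
have h13 : (31 / 30 : R) ^+ 13 <= 16 / 10 by rewrite !exprS expr0; lra.
have h1 : ((31 / 30 : R) ^+ 13) ^+ p <= (16 / 10) ^+ p.
  rewrite lerXn2r ?nnegrE ?exprn_ge0 //; lra.
have h2 : (2 : R) ^+ p = (16 / 10) ^+ p * (1 + 1 / 4) ^+ p.
  by rewrite -exprMn; congr (_ ^+ _); lra.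
have h3 : 1 <= (16 / 10 : R) ^+ p by apply: exprn_ege1; lra.
have h4 : 7 <= (1 + 1 / 4 : R) ^+ p.
  have : (24 : R) <= p%:R by rewrite (ler_nat R 24 p).
  have q0 : (0 : R) <= 1 / 4 by lra.
  have := bernoulli p q0; lra.
have : (16 / 10 : R) ^+ p * 7 <= 2 ^+ p by rewrite h2 ler_wpM2l //; lra.
lra.
Qed.

(* The choice of [s] balances the losses [theta = 1/1000] in the degrees against
   [31/30 <= tau]; it still has [tau <= s ^ 2]. *)
Lemma correlation_contradiction (p k q n : nat) (rho u tau s : R) :
  q = (13 * p + 1)%N -> n = (20 * 100 * p)%N ->
  tau = (31 / 30) ^+ k -> s = tau * (992 / 1000) ->
  (24 <= p)%N -> (0 < k)%N -> tau <= 2 ^+ p -> 0 < rho ->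
  rho * 2 ^+ (24 * q * p) <= 1 -> u <= 1 ->
  ((31 / 30) ^+ (23 * q * k))^-1 <= u ->
  (tau - 4 / 1000) * u <= s * (u + rho) * (1001 / 1000) +
     2 ^+ p / 50 * (s * (u + rho) * rho + (s ^+ n.-1)^-1) ->
  False.
Proof.
move=> qE nE tauE sE p24 k0 tau2 rho_gt0 rho_small u1.
have -> : (31 / 30 : R) ^+ (23 * q * k) = tau ^+ (23 * q).
  by rewrite mulnC exprM tauE.
move=> uk; have t0 : 31 / 30 <= tau.
  rewrite tauE; case: k k0 {tauE} => // k _.
  by rewrite exprS ler_peMr ?exprn_ege1 //; lra.
have stau : s <= tau by rewrite sE; lra.
have s2 : tau <= s ^+ 2.
  have -> : s ^+ 2 = tau * (tau * (992 / 1000 * (992 / 1000))) by rewrite sE; ring.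
  by rewrite ler_peMr //; lra.
have s_gt0 : 0 < s by rewrite sE; lra.
have s1 : 1 <= s.
  rewrite leNgt; apply/negP => s1.
  have : s ^+ 2 <= 1 by rewrite expr_le1 // ltW.
  lra.
clear tauE.
have tq0 : 0 < tau ^+ (23 * q) by apply: exprn_gt0; lra.
have u0 : 0 < u by apply: lt_le_trans uk; rewrite invr_gt0.
have utq : 1 <= u * tau ^+ (23 * q) by rewrite -ler_pdivrMr // div1r.
set P := (2 : R) ^+ p in tau2 *.
have Pbig : 1000 * 1000 <= P := expr2_ge_24 p24.
have P0 : 0 < P by lra.
have rhoP : rho * P ^+ 2 <= u.
  rewrite -(ler_pM2r tq0); apply: le_trans utq; apply: le_trans rho_small.
  rewrite -mulrA ler_wpM2l //; first exact: ltW.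
  apply: (@le_trans _ _ (P ^+ 2 * P ^+ (23 * q))).
    rewrite ler_wpM2l ?sqr_ge0 //.
    rewrite lerXn2r ?nnegrE //; lra.
  rewrite -exprD /P -exprM ler_weXn2l //; first by lra.
  have h : (2 + 23 * q <= 24 * q)%N by clear -qE p24; lia.
  rewrite [X in (X <= _)%N]mulnC; exact: leq_mul h (leqnn p).
have rho1 : rho * P <= u / (1000 * 1000).
  have : rho * P * (1000 * 1000) <= rho * P * P by rewrite ler_wpM2l // mulr_ge0 ?ltW.
  rewrite expr2 mulrA in rhoP; lra.
have rho2 : rho <= u / (1000 * 1000).
  have : rho * 1 <= rho * P by rewrite ler_wpM2l //; lra.
  lra.
(* As n - 1 >= 2 (23 q + 60 p) and s^2 >= tau, the power s^(n-1) is at least tau^(23 q) tau^(60 p).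
   The first factor pays for the density [u], the second for P^2. *)
have spow : P ^+ 2 <= u * s ^+ n.-1.
  apply: (@le_trans _ _ (u * tau ^+ (23 * q) * tau ^+ (60 * p))).
    apply: (@le_trans _ _ (tau ^+ (60 * p))); last first.
      by rewrite ler_peMl // exprn_ge0 //; lra.
    apply: (@le_trans _ _ ((31 / 30) ^+ (60 * p))); last first.
      rewrite lerXn2r ?nnegrE //; lra.
    have -> : (31 / 30 : R) = 1 + 1 / 30 by lra.
    have -> : P ^+ 2 = 2 ^+ (2 * p) by rewrite /P -exprM mulnC.
    have -> : (60 * p = 30 * (2 * p))%N by clear; lia.
    apply: expr_mul_ge_bernoulli; lra.
  rewrite -mulrA ler_wpM2l //; first exact: ltW.
  rewrite -exprD; apply: (@le_trans _ _ ((s ^+ 2) ^+ (23 * q + 60 * p))).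
    rewrite lerXn2r ?nnegrE ?sqr_ge0 //; lra.
  rewrite -exprM ler_weXn2l //; clear -qE nE p24; lia.
have sn0 : 0 < s ^+ n.-1 by rewrite exprn_gt0.
have e3 : P / 50 * (s ^+ n.-1)^-1 <= u / (1000 * 10).
  rewrite ler_pdivrMr //.
  have : P * 2000 <= P ^+ 2 by rewrite expr2 ler_wpM2l //; lra.
  lra.
have e1 : s * (u + rho) <= s * (u * (1 + 1 / (1000 * 10))) by rewrite ler_wpM2l //; lra.
set a := s * (u + rho) in e1 *.
have a0 : 0 <= a by apply: mulr_ge0; lra.
have e2 : a * (rho * P) <= a * (1 / (1000 * 1000)) by rewrite ler_wpM2l //; lra.
have w1 : 31 / 30 * u <= tau * u by rewrite ler_wpM2r // ltW.
have e1' : a <= 992 / 1000 * (1 + 1 / (1000 * 10)) * (tau * u).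
  by apply: le_trans e1 _; rewrite sE; lra.
(* The main term 0.992 * 1.001 * tau u stays below (tau - 0.004) u because tau >= 31/30; every other
   term is a tiny multiple of [u]. *)
move: e3; set b := (_ ^+ _)^-1 => e3 H.
have E : P / 50 * (a * rho + b) = a * (rho * P) / 50 + P / 50 * b by field.
rewrite mulrBl E in H.
clear -H e1' w1 e2 e3 u0.
move: (tau * u) (P / 50 * b) (a * (rho * P)) H e1' w1 e2 e3 => w pb arp *; lra.
Qed.
End Numerics.

(** * Regular densities: degrees, moments and triangles *)

Lemma eq_lexx {R : realType} (x y : R) : x = y -> x <= y.
Proof. by move->. Qed.

Lemma bad_degree_cases {R : realType} (d t : R) : t <= d ->
  (~~ ((998 / 1000 <= t) && (t <= 1001 / 1000)))%R%:R <=
  (d < 1 - 1 / 1000)%R%:R + (1 + 1 / 1000 < d)%R%:R + (1 / 1000 < d - t)%R%:R :> R.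
Proof.
move=> td; have ind0 (b : bool) : (0 : R) <= b%:R by exact: ler0n.
have h0 := addr_ge0 (addr_ge0 (ind0 (d < 1 - 1 / 1000)) (ind0 (1 + 1 / 1000 < d)))
  (ind0 (1 / 1000 < d - t)).
case: (leP (998 / 1000)) => h1 /=; last first.
  have [h2|h2] := ltP d (1 - 1 / 1000); first by rewrite -addrA lerDl addr_ge0.
  have -> : 1 / 1000 < d - t by clear -h1 h2; lra.
  by rewrite lerDr addr_ge0.
case: (leP _ (1001 / 1000)) => h2 //=.
have -> : 1 + 1 / 1000 < d by clear -h2 td; lra.
by rewrite addrAC lerDr addr_ge0.
Qed.

Section Pair.
Context {R : realType}.
Variables (X Z : finType) (pX : X -> R) (pZ : Z -> R) (g : X -> Z -> R).
Variables (rho : R) (p : nat).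

(** The window is asymmetric because truncation only lowers degrees: 1/1000 is allowed for the
    degree of [g] on either side, and another 1/1000 below for the truncation. *)
Definition good_degree (x : X) : bool :=
  (998 / 1000 <= avg pZ (truncate g (2 * (2 ^+ p / 100)) x)) &&
  (avg pZ (truncate g (2 * (2 ^+ p / 100)) x) <= 1001 / 1000).

(** The exponent 2000 p serves two purposes: (1 + 0.00089)^2000 >= 2 makes high degrees rarer than
    2^(-p), and the heavy rectangle is excluded through the lower bound on s^(n-1). *)
Record regular_density : Prop := RegularDensity {
  rd_probX : prob_weight pX;
  rd_probZ : prob_weight pZ;
  rd_ge0 : forall x z, 0 <= g x z;
  rd_avg : avg pX (fun x => avg pZ (g x)) = 1;
  rd_spread : spread pX pZ g (2 ^+ p / 100) rho;
  rd_extremal : extremal pX (fun x => avg pZ (g x)) rho (20 * 100 * p);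
  rd_rect : rect_extremal pX pZ g rho (20 * 100 * p) }.

End Pair.

Lemma rho_expr2_small {R : realType} (rho : R) (p : nat) : (24 <= p)%N -> 0 < rho ->
  rho * 2 ^+ (24 * (13 * p + 1) * p) <= 1 ->
  rho * 2 ^+ p ^+ 2 * (1000 * 1000) <= 1.
Proof.
move=> p24 rho_gt0 rho_small; apply: le_trans rho_small.
rewrite -mulrA ler_wpM2l //; first exact: ltW.
apply: (@le_trans _ _ (2 ^+ p ^+ 2 * 2 ^+ p)).
  by rewrite ler_wpM2l ?sqr_ge0 ?expr2_ge_24 .
rewrite -exprM -exprD ler_weXn2l //; first by lra.
have h : (p * 2 + p = 3 * p)%N by clear; lia.
have h' : (3 <= 24 * (13 * p + 1))%N by clear; lia.
by rewrite h; exact: leq_mul h' (leqnn p).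
Qed.

(** Low degrees do not occur; high degrees, and by Markov's inequality large truncation losses, have
    measure at most 2^(-p) each. *)
Lemma bad_degree_small {R : realType} (X Z : finType) (pX : X -> R) (pZ : Z -> R)
    (g : X -> Z -> R) (rho : R) (p : nat) :
  regular_density pX pZ g rho p -> (24 <= p)%N -> 0 < rho ->
  rho * 2 ^+ (24 * (13 * p + 1) * p) <= 1 ->
  avg pX (fun x => (~~ good_degree pZ g p x)%:R) <= 2 / 2 ^+ p.
Proof.
move=> reg p24 rho_gt0 rho_small.
pose K : R := 2 ^+ p / 100; pose gt := truncate g (2 * K).
have pX0 := (rd_probX reg).1; have pZ0 := (rd_probZ reg).1.
have Pbig := @expr2_ge_24 R _ p24; set P := (2 : R) ^+ p in Pbig *.
have P0 : 0 < P by lra.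
have K0 : 0 < K by rewrite /K -/P; lra.
have rhoP := rho_expr2_small p24 rho_gt0 rho_small; rewrite -/P in rhoP.
have rho_P : rho * P <= 1 / (1000 * 1000) / P.
  by rewrite ler_pdivlMr //; rewrite expr2 in rhoP; clear -rhoP; lra.
have rho1 : rho <= 1 / (1000 * 1000) / P.
  by apply: le_trans rho_P; rewrite ler_peMr ?ltW //; clear -Pbig; lra.
have rho2 : rho <= 1 / (1000 * 1000).
  by apply: le_trans rho1 _; rewrite ler_pdivrMr //; clear -Pbig; lra.
pose d x := avg pZ (g x).
have d0 x : 0 <= d x by apply: avg_ge0 => // z; exact: rd_ge0 reg _ _.
pose loss x := d x - avg pZ (gt x).
have loss0 x : 0 <= loss x.
  by rewrite subr_ge0; apply: le_avg => // z; apply: truncate_le_id.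
have loss_avg : avg pX loss <= 2 * K * rho.
  apply: le_trans (truncation_loss (rd_probX reg) (rd_probZ reg)
    K0 (rd_spread reg)).
  by apply: le_avg => // x; rewrite avgB.
have low : avg pX (fun x => (d x < 1 - 1 / 1000)%R%:R) = 0.
  apply: (no_low_degree (rd_probX reg) (rd_avg reg) (rd_extremal reg)) => //.
    by clear; lra.
  rewrite !natrM; have : (24 : R) <= p%:R by rewrite (ler_nat R 24 p).
  move=> h; have : 20 * 100 * 24 * (1 / 1000 - rho) <= 20 * 100 * p%:R * (1 / 1000 - rho).
    by apply: ler_wpM2r; [clear -rho2 | clear -h]; lra.
  clear -rho2; lra.
have high : avg pX (fun x => (1 + 1 / 1000 < d x)%R%:R) <= 1 / P.
  set m := avg pX _; rewrite leNgt; apply/negP => m_big.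
  have rhom : rho <= 1 / 1000 / 10 * m.
    have : 0 <= 1 / P by rewrite divr_ge0 // ltW.
    clear -rho1 m_big; lra.
  have th0 : (0 : R) <= 1 / 1000 by clear; lra.
  have th1 : (10 : R) * (1 / 1000) <= 1 by clear; lra.
  have := few_high_degree (rd_probX reg) (ltW rho_gt0) (erefl m)
    (rd_extremal reg) th0 th1 rhom.
  have : (2 : R) ^+ p <= (1 + 89 / 100 * (1 / 1000)) ^+ (20 * 100 * p).
    by apply: expr_mul_ge_bernoulli; rewrite ?natrM; clear; lra.
  rewrite -/P => h1.
  apply/negP; rewrite -ltNge.
  have m0 : 0 < m by apply: lt_trans m_big; rewrite divr_gt0.
  apply: lt_le_trans (ler_wpM2r (ltW m0) h1).
  by rewrite mulrC -ltr_pdivrMr.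
have lossy : avg pX (fun x => (1 / 1000 < loss x)%R%:R) <= 1 / P.
  have : avg pX (fun x => (1 / 1000 < loss x)%R%:R) <= 1000 * avg pX loss.
    rewrite -avgZ; apply: le_avg => // x; have := loss0 x.
    by clear; case: ltP => /=; lra.
  move/le_trans; apply; apply: (@le_trans _ _ (1000 * (2 * K * rho))).
    by rewrite ler_wpM2l.
  rewrite /K -/P.
  have : 0 < 1 / P by rewrite divr_gt0.
  clear -rho_P; lra.
apply: (@le_trans _ _ (avg pX (fun x => (d x < 1 - 1 / 1000)%R%:R +
   (1 + 1 / 1000 < d x)%R%:R + (1 / 1000 < loss x)%R%:R))); last first.
  rewrite !avgD low; clear -high lossy; lra.
apply: le_avg => // x; rewrite /good_degree -/K -/gt.
by apply: bad_degree_cases; have := loss0 x; rewrite subr_ge0.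
Qed.

(** Otherwise [kernel_power_binomial] makes the [q]-th moment of 1 plus the kernel at least (13/6)^p
    >= 2^p. On good vertices this quantity is at most the correlation [M] plus 4/1000, so some [x]
    has many [x'] with correlation about [tau]. These [x'], and the [z] where they have large
    average density, form a rectangle that extremality forbids. *)
Lemma truncated_moment_lt {R : realType} (X Z : finType) (pX : X -> R) (pZ : Z -> R)
    (g : X -> Z -> R) (rho : R) (p : nat)
    (c := fun x => pX x * (good_degree pZ g p x)%:R)
    (a := fun x z => truncate g (2 * (2 ^+ p / 100)) x z - 1) :
  regular_density pX pZ g rho p -> (24 <= p)%N -> ~~ odd p -> 0 < rho ->
  rho * 2 ^+ (24 * (13 * p + 1) * p) <= 1 ->
  \sum_x \sum_x' c x * c x' * avg pZ (fun z => a x z * a x' z) ^+ p < (6 ^+ p)^-1.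
Proof.
move=> reg p24 pE rho_gt0 rho_small; rewrite ltNge; apply/negP => big.
pose q := (13 * p + 1)%N; pose n := (20 * 100 * p)%N.
pose K : R := 2 ^+ p / 100; pose gt := truncate g (2 * K).
have pX0 := (rd_probX reg).1; have pZ0 := (rd_probZ reg).1.
have g0 := rd_ge0 reg.
have Pbig := @expr2_ge_24 R _ p24.
have K0 : 0 < K by rewrite /K; clear -Pbig; lra.
have gt0 x z : 0 <= gt x z := truncate_ge0 g0 K0 x z.
have gtK x z : gt x z <= 2 * K := truncate_le g K x z.
have c0 x : 0 <= c x by rewrite mulr_ge0.
have c1 : \sum_x c x <= 1.
  rewrite -(rd_probX reg).2; apply: ler_sum => x _.
  by rewrite ler_piMr //; case: good_degree.
pose M x x' := avg pZ (fun z => gt x z * gt x' z).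
(* 4/1000 = 2 - 2 * 998/1000 is the cost of the two degrees in [aM]. *)
pose W x x' := M x x' + 4 / 1000.
have M0 x x' : 0 <= M x x' by apply: avg_ge0 => // z; rewrite mulr_ge0.
have W0 x x' : 0 <= W x x' by rewrite addr_ge0 //; lra.
have aM x x' : 1 + avg pZ (fun z => a x z * a x' z) =
    M x x' - avg pZ (gt x) - avg pZ (gt x') + 2.
  have -> : avg pZ (fun z => a x z * a x' z) =
    avg pZ (fun z => gt x z * gt x' z - gt x z - gt x' z + 1).
    by apply: eq_avg => z; rewrite /a /gt /K; ring.
  by rewrite avgD !avgB (avg_cst _ (rd_probZ reg)) /M; ring.
have sumW : 2 ^+ p <= avg c (fun x => avg c (fun x' => W x x' ^+ q)).
  apply: (@le_trans _ _
      (\sum_x \sum_x' c x * c x' * (1 + avg pZ (fun z => a x z * a x' z)) ^+ q)).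
    apply: le_trans (kernel_power_binomial a c pZ0 (_ : p <= q)%N); last first.
      by rewrite /q; clear; lia.
    have bin : (13 ^+ p : R) <= 'C(q, p)%:R.
      by rewrite -natrX ler_nat leq_expn_bin // /q; clear; lia.
    apply: (@le_trans _ _ (13 ^+ p * (6 ^+ p)^-1)); last first.
      apply: ler_pM => //; first by rewrite exprn_ge0.
      by rewrite invr_ge0 exprn_ge0.
    rewrite -exprVn -exprMn lerXn2r ?nnegrE //; clear; lra.
  apply: ler_sum => x _; rewrite mulr_sumr; apply: ler_sum => x' _.
  rewrite mulrA; rewrite /c.
  have [gx|_] := boolP (good_degree pZ g p x); last by rewrite !mulr0 !mul0r.
  have [gx'|_] := boolP (good_degree pZ g p x'); last by rewrite !mulr0 !mul0r.
  rewrite !mulr1 ler_wpM2l ?mulr_ge0 // aM.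
  move: gx gx'; rewrite /good_degree -/K -/gt => /andP[h1 _] /andP[h2 _].
  set b := _ + 2; have bW : b <= W x x' by rewrite /b /W; clear -h1 h2; lra.
  (* Since [p] is even, [q] is odd, and a negative base only lowers the sum. *)
  have [b0|b0] := leP 0 b; first by rewrite lerXn2r ?nnegrE.
  apply: (@le_trans _ _ 0); last exact: exprn_ge0.
  by rewrite real_exprn_odd_le0 ?num_real ?ltW // /q oddD oddM (negbTE pE).
have P0 : (0 : R) < 2 ^+ p by lra.
have [x cx Wx] := exists_ge_avg c0 c1 P0 sumW.
have gx : good_degree pZ g p x.
  by move: cx; rewrite /c; case: good_degree => //; rewrite mulr0 ltxx.
have WB x' : W x x' < 2 ^+ p.
  have : M x x' <= 2 * K * (1001 / 1000).
    apply: (@le_trans _ _ (2 * K * avg pZ (gt x))).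
      rewrite -avgZ; apply: le_avg => // z; rewrite mulrC ler_wpM2r //.
    rewrite ler_wpM2l //; first by rewrite mulr_ge0 // ltW.
    by case/andP: gx.
  rewrite /W /K; clear -Pbig; lra.
have lt2 : (2 : R) ^+ p <= (31 / 30) ^+ (30 * p).
  have -> : (31 / 30 : R) = 1 + 1 / 30 by clear; lra.
  by apply: expr_mul_ge_bernoulli; clear; lra.
have t2q : (2 : R) <= (31 / 30) ^+ (21 * q).
  have t30 : (0 : R) <= 1 / 30 by clear; lra.
  have := bernoulli (21 * q) t30.
  have -> : (1 + 1 / 30 : R) = 31 / 30 by clear; lra.
  apply: le_trans; rewrite /q natrM natrD natrM.
  have : (24 : R) <= p%:R by rewrite (ler_nat R 24 p).
  by clear; lra.
have [||||| k k0 uk] := @level_set R X c (W x) (31 / 30) q (30 * p) c0 c1 (W0 x).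
- by clear; lra.
- by rewrite /q addn1.
- exact: t2q.
- by move=> x'; apply: lt_le_trans (WB x') lt2.
- by apply: lt_le_trans (@level_start_lt R p p24) Wx.
pose tau : R := (31 / 30) ^+ k.
pose A x' := good_degree pZ g p x' && (tau <= W x x').
set u := avg c _ in uk.
have uE : avg pX (fun x' => (A x')%:R) = u.
  rewrite /u /avg; apply: eq_bigr => x' _; rewrite /c /A.
  by rewrite -mulrA -natrM mulnb.
have u1 : u <= 1.
  rewrite -uE -[leRHS](avg_cst 1 (rd_probX reg)); apply: le_avg => // x'.
  by case: (A x').
have tk0 : 0 < (31 / 30 : R) ^+ (23 * q * k) by apply: exprn_gt0; lra.
have u0 : 0 < u by apply: lt_le_trans uk; rewrite invr_gt0.
have tau2 : tau <= 2 ^+ p.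
  have [x' _ h] := exists_ge_avg pX0 (eq_lexx (rd_probX reg).2) u0 (eq_lexx (esym uE)).
  have : A x' by move: h; case: (A x') => //; rewrite leNgt u0.
  by case/andP => _ h'; apply: le_trans h' (ltW (WB x')).
pose s : R := tau * (992 / 1000).
apply: (@correlation_contradiction R p k q n rho u tau s (erefl _) (erefl _)
  (erefl _) (erefl _) p24 k0 tau2 rho_gt0 rho_small u1 uk).
have s0 : 0 < s by apply: mulr_gt0; [apply: exprn_gt0 |]; clear; lra.
have n0 : (0 < n)%N by rewrite /n; clear -p24; lia.
have L0 : 0 <= 2 * K by rewrite mulr_ge0 // ltW.
have := @correlation_le R X Z pX pZ g rho n (rd_probX reg) (rd_probZ reg) g0
  (ltW rho_gt0) A (gt x) (2 * K) s u (rd_rect reg) n0 s0 L0.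
have -> : 2 * K = 2 ^+ p / 50 by rewrite /K; clear -Pbig; lra.
have gtP z : 0 <= gt x z <= 2 ^+ p / 50.
  by rewrite gt0; apply: le_trans (gtK x z) _; rewrite /K; clear -Pbig; lra.
move/(_ gtP uE); set lhs := avg pZ _ => le1.
(* The copy of the density at [x'] becomes the untruncated [g], since extremality bounds masses of
   [g] itself; the copy at [x] stays truncated, as a bounded test function of [z]. *)
apply: (@le_trans _ _ lhs).
  rewrite /lhs -uE -avgZ.
  under [leRHS]eq_avg do rewrite -avgZ.
  rewrite avg_exchange; apply: le_avg => // x'.
  rewrite /A; case: (boolP (_ && _)) => /= [/andP[gx' tW]|_].
    rewrite mulr1; apply: (@le_trans _ _ (M x x')); first by move: tW; rewrite /W; clear; lra.
    apply: le_avg => // z; rewrite mulr1 ler_wpM2l //; exact: truncate_le_id.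
  rewrite mulr0; apply: avg_ge0 => // z; by rewrite !mulr_ge0.
apply: le_trans le1 _; rewrite lerD2r ler_wpM2l //; last by case/andP: gx.
by rewrite mulr_ge0 ?addr_ge0 ?ltW.
Qed.

(** The truncated [f] has mass almost 1 and is at most [L], so a small count forces the codegree [D]
    to be at most 1/2 on measure about 1/L. There the kernel of g - 1 and h - 1 is below -1/3, and
    the even [p]-th moment reaches 16 * 6^(-p), more than the one-sided moments allow. *)
Lemma truncated_triangle_ge {R : realType} (X Y Z : finType)
    (pX : X -> R) (pY : Y -> R) (pZ : Z -> R)
    (f : X -> Y -> R) (g : X -> Z -> R) (h : Y -> Z -> R) (rho : R) (p : nat)
    (L := 2 * (2 ^+ p / 100)) :
  (24 <= p)%N -> ~~ odd p -> 0 < rho ->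
  rho * 2 ^+ (24 * (13 * p + 1) * p) <= 1 ->
  (forall x y, 0 <= f x y) -> avg pX (fun x => avg pY (f x)) = 1 ->
  spread pX pY f (2 ^+ p / 100) rho ->
  regular_density pX pZ g rho p -> regular_density pY pZ h rho p ->
  1 / 4 <= avg pX (fun x => avg pY (fun y => avg pZ (fun z =>
    truncate f L x y * (truncate g L x z * truncate h L y z)))).
Proof.
move=> p24 pE rho_gt0 rho_small f0 f1 fS rg rh; rewrite leNgt; apply/negP => Tlt.
have Pbig := @expr2_ge_24 R _ p24.
have K0 : (0 : R) < 2 ^+ p / 100 by clear -Pbig; lra.
have pXP := rd_probX rg; have pYP := rd_probX rh; have pZP := rd_probZ rg.
have pX0 := pXP.1; have pY0 := pYP.1; have pZ0 := pZP.1.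
pose ft := truncate f L; pose gt := truncate g L; pose ht := truncate h L.
have ft0 x y : 0 <= ft x y := truncate_ge0 f0 K0 x y.
have gt0 x z : 0 <= gt x z := truncate_ge0 (rd_ge0 rg) K0 x z.
have ht0 y z : 0 <= ht y z := truncate_ge0 (rd_ge0 rh) K0 y z.
have ftL x y : ft x y <= L := truncate_le f (2 ^+ p / 100) x y.
pose D x y := avg pZ (fun z => gt x z * ht y z).
have D0 x y : 0 <= D x y by apply: avg_ge0 => // z; rewrite mulr_ge0.
pose T := avg pX (fun x => avg pY (fun y => ft x y * D x y)).
have TE : T < 1 / 4.
  apply: le_lt_trans Tlt; apply: le_avg => // x; apply: le_avg => // y.
  by rewrite /D -avgZ.
have ft_avg : 1 - L * rho <= avg pX (fun x => avg pY (ft x)).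
  have := truncation_loss pXP pYP K0 fS.
  have -> : avg pX (fun x => avg pY (fun y => f x y - truncate f (2 * (2 ^+ p / 100)) x y))
    = 1 - avg pX (fun x => avg pY (ft x)).
    transitivity (avg pX (fun x => avg pY (f x)) - avg pX (fun x => avg pY (ft x))).
      by rewrite -avgB; apply: eq_avg => x; rewrite avgB.
    by rewrite f1.
  by rewrite -/L; clear; lra.
pose m := avg pX (fun x => avg pY (fun y => (D x y <= 1 / 2)%R%:R)).
have ft_le : avg pX (fun x => avg pY (ft x)) <= 2 * T + L * m.
  rewrite -!avgZ -avgD; apply: le_avg => // x; rewrite -!avgZ -avgD.
  apply: le_avg => // y; case: (leP (D x y) (1 / 2)) => hD /=.
    by rewrite mulr1; apply: le_trans (ftL x y) _; rewrite lerDr !mulr_ge0.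
  rewrite mulr0 addr0 mulrCA ler_peMr //; clear -hD; lra.
have rhoP := rho_expr2_small p24 rho_gt0 rho_small.
set P := (2 : R) ^+ p in Pbig rhoP K0.
have P0 : 0 < P by clear -Pbig; lra.
(* From 1 - L rho <= 2 T + L m with T < 1/4 and L = P/50, the measure is nearly 25/P. Dropping bad
   vertices on both sides then costs 4/P. *)
have m_ge : 20 / P <= m.
  rewrite ler_pdivrMr //.
  have Lrho : L * rho <= 1 / 1000.
    have h1 : rho * P <= rho * P ^+ 2.
      rewrite ler_wpM2l //; first exact: ltW.
      by rewrite expr2 ler_peMr //; [exact: ltW | clear -Pbig; lra].
    by rewrite /L -/P; clear -rhoP h1; lra.
  have LE : L = P / 50 by rewrite /L -/P; clear; lra.
  have := le_trans ft_avg ft_le; rewrite LE; rewrite LE in Lrho.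
  by move=> h1; clear -h1 Lrho TE; lra.
pose gx := good_degree pZ g p; pose gy := good_degree pZ h p.
pose m' := avg pX (fun x => avg pY (fun y =>
  (gx x)%:R * (gy y)%:R * (D x y <= 1 / 2)%R%:R)).
have m'_ge : 16 / P <= m'.
  have bx := bad_degree_small rg p24 rho_gt0 rho_small.
  have by_ := bad_degree_small rh p24 rho_gt0 rho_small.
  have : m <= m' + avg pX (fun x => (~~ gx x)%:R) + avg pY (fun y => (~~ gy y)%:R).
    have -> : avg pX (fun x => (~~ gx x)%:R) =
        avg pX (fun x => avg pY (fun y => (~~ gx x)%:R)).
      by apply: eq_avg => x; rewrite avg_cst.
    rewrite -[X in _ <= _ + X](avg_cst _ pXP) -!avgD /m.
    apply: le_avg => // x; rewrite -!avgD; apply: le_avg => // y.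
    case: (D x y <= 1 / 2); case: (gx x); case: (gy y); rewrite /=; clear; lra.
  rewrite -/P in bx by_; move=> h1.
  have e16 : 16 / P = 20 / P - 2 / P - 2 / P by field; rewrite gt_eqF.
  by rewrite e16; clear -h1 bx by_ m_ge; lra.
pose cx x := pX x * (gx x)%:R; pose cy y := pY y * (gy y)%:R.
pose a x z := gt x z - 1; pose b y z := ht y z - 1.
have key : 16 / P * (3 ^+ p)^-1 <=
    \sum_x \sum_y cx x * cy y * avg pZ (fun z => a x z * b y z) ^+ p.
  apply: (@le_trans _ _ (m' * (3 ^+ p)^-1)).
    by rewrite ler_wpM2r // invr_ge0 exprn_ge0.
  rewrite -avgZr; apply: ler_sum => x _; rewrite -avgZr /avg mulr_sumr.
  apply: ler_sum => y _; rewrite /cx /cy.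
  have abE : avg pZ (fun z => a x z * b y z) =
      D x y - avg pZ (gt x) - avg pZ (ht y) + 1.
    have -> : avg pZ (fun z => a x z * b y z) =
      avg pZ (fun z => gt x z * ht y z - gt x z - ht y z + 1).
      by apply: eq_avg => z; rewrite /a /b; ring.
    by rewrite avgD !avgB (avg_cst _ pZP).
  have [gdx|_] := boolP (gx x); last by rewrite !(mulr0, mul0r).
  have [gdy|_] := boolP (gy y); last by rewrite !(mulr0, mul0r).
  rewrite !mulr1 mulrA ler_wpM2l ?mulr_ge0 //.
  case: (leP (D x y) (1 / 2)) => hD /=; last first.
    by rewrite mulr0 mul0r -(odd_double_half p) (negbTE pE) add0n -mul2n exprM exprn_ge0 ?sqr_ge0.
  rewrite mulr1 mul1r -exprVn [X in _ <= X ^+ p]abE.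
  case/andP: gdx => d1 _; case/andP: gdy => d2 _.
  (* 1/2 - 2 * 998/1000 + 1 = -496/1000. *)
  set dd := _ + 1; have ddle : 3^-1 <= - dd by rewrite /dd; clear -d1 d2 hD; lra.
  have -> : dd ^+ p = (- dd) ^+ p.
    by rewrite exprNn -signr_odd (negbTE pE) expr0 mul1r.
  by rewrite lerXn2r ?nnegrE //; clear -ddle; lra.
have := kernel_power_cross a b cx cy p pZ0.
have h1 := truncated_moment_lt rg p24 pE rho_gt0 rho_small.
have h2 := truncated_moment_lt rh p24 pE rho_gt0 rho_small.
apply/negP; rewrite -ltNge.
apply: (@lt_le_trans _ _ (2 * (6 ^+ p)^-1)).
  by rewrite mulr_natl mulr2n; apply: ltrD.
rewrite ler_wpM2l //; apply: le_trans key.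
have -> : (6 ^+ p)^-1 = P^-1 * (3 ^+ p)^-1 :> R.
  by rewrite /P -invfM -exprMn; congr (_ ^+ _)^-1; clear; lra.
have i0 : 0 <= P^-1 by rewrite invr_ge0 ltW.
rewrite ler_wpM2r ?invr_ge0 ?exprn_ge0 //.
by clear -i0; lra.
Qed.

(** * Densities of sets and volume of the extremal box *)

Section Sets.
Context {R : realType}.

Definition dens (T : finType) (A : {set T}) : R := #|A|%:R / #|T|%:R.

Definition uniform_on (T : finType) (A : {set T}) (t : T) : R :=
  (t \in A)%:R / #|A|%:R.

Lemma dens_ge0 (T : finType) (A : {set T}) : 0 <= dens A.
Proof. by rewrite divr_ge0. Qed.

Lemma dens_gt0 (T : finType) (A : {set T}) : 0 < dens A -> (0 < #|A|)%N.
Proof. by rewrite lt0n; apply: contraTneq => e; rewrite /dens e mul0r ltxx. Qed.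

Lemma dens_le1 (T : finType) (A : {set T}) : dens A <= 1.
Proof.
rewrite /dens; have [->|] := posnP #|T|; first by rewrite invr0 mulr0.
by move=> T0; rewrite ler_pdivrMr ?ltr0n // mul1r ler_nat max_card.
Qed.

Lemma densT (T : finType) : (0 < #|T|)%N -> dens [set: T] = 1.
Proof. by move=> T0; rewrite /dens cardsT divff // pnatr_eq0 -lt0n. Qed.

Lemma densX (T U : finType) (A : {set T}) (B : {set U}) :
  dens (setX A B) = dens A * dens B.
Proof. by rewrite /dens cardsX card_prod !natrM invfM mulrACA. Qed.

Lemma sum_indicator (T : finType) (A : {set T}) :
  \sum_t (t \in A)%:R = #|A|%:R :> R.
Proof. by rewrite -natr_sum -big_mkcond sum1_card. Qed.

Lemma uniform_on_prob (T : finType) (A : {set T}) : (0 < #|A|)%N ->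
  prob_weight (uniform_on A).
Proof.
move=> A0; split=> [t|]; first by rewrite divr_ge0.
by rewrite -mulr_suml sum_indicator divff // pnatr_eq0 -lt0n.
Qed.

Lemma avg_uniform_on (T : finType) (A : {set T}) (P : T -> bool) : (0 < #|A|)%N ->
  avg (uniform_on A) (fun t => (P t)%:R) * dens A = dens [set t in A | P t].
Proof.
move=> A0; rewrite /dens mulrA; congr (_ / _).
rewrite -[RHS]sum_indicator /avg mulr_suml; apply: eq_bigr => t _.
rewrite inE /uniform_on -mulnb natrM; field.
by rewrite pnatr_eq0 -lt0n.
Qed.

Lemma avg_uniform_on2 (T U : finType) (A : {set T}) (B : {set U})
    (P : T -> U -> bool) : (0 < #|A|)%N -> (0 < #|B|)%N ->
  avg (uniform_on A) (fun t => avg (uniform_on B) (fun u => (P t u)%:R)) *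
    (dens A * dens B) = dens [set w | [&& w.1 \in A, w.2 \in B & P w.1 w.2]].
Proof.
move=> A0 B0; rewrite /dens mulrACA -invfM -[X in _ * (X / _)]natrM -[X in _ * (_ / X)]natrM.
rewrite card_prod mulrA; congr (_ / _).
rewrite -[RHS]sum_indicator; under [RHS]eq_bigr do rewrite inE.
rewrite -(pair_bigA _ (fun t u => [&& t \in A, u \in B & P t u]%:R)) /=.
rewrite /avg mulr_suml; apply: eq_bigr => t _.
rewrite mulr_sumr mulr_suml; apply: eq_bigr => u _.
rewrite /uniform_on -!mulnb !natrM; field.
by rewrite !pnatr_eq0 -!lt0n A0 B0.
Qed.

Lemma le_expr1D (x : R) (m : nat) : 0 <= x -> m%:R * x <= 1 / 2 ->
  (1 + x) ^+ m <= 1 + 2 * m%:R * x.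
Proof.
move=> x0; elim: m => [|m IH]; first by rewrite expr0 mulr0 mul0r addr0.
rewrite -natr1 mulrDl mul1r => mx.
have mx' : m%:R * x <= 1 / 2 by lra.
rewrite exprSr; apply: le_trans (ler_wpM2r _ (IH mx')) _; first by lra.
have : m%:R * x * x <= 1 / 2 * x by rewrite ler_wpM2r.
lra.
Qed.

(** Compares the box, of padded volume [v], with the whole space, of mass 1 and padded volume [w].
    As v <= w, the comparison gives v^n <= (nu w)^n; inserting nu <= K0 v instead shows that the
    volume is at least K0^(-n) / 2. *)
Lemma extremal_box_bounds (n : nat) (K0 v nu w : R) : (0 < n)%N ->
  0 < K0 -> 0 < v -> 0 <= nu -> 0 < w -> w <= 2 -> w ^+ n.-1 <= 2 -> v <= w ->
  nu <= K0 * v -> v ^+ n.-1 <= nu ^+ n * w ^+ n.-1 ->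
  v / 2 <= nu /\ 1 <= 2 * K0 ^+ n * v.
Proof.
case: n => // m _ K00 v0 nu0 w0 w2 /= wm vw nuK max; split.
  have : v <= nu * w.
    rewrite -(@ler_pXn2r _ m.+1) // ?nnegrE ?mulr_ge0 ?(ltW v0) ?(ltW w0) //.
    rewrite exprSr exprMn [w ^+ m.+1]exprSr mulrA; apply: ler_pM => //.
      exact/exprn_ge0/ltW.
    exact: ltW.
  have : nu * w <= nu * 2 by rewrite ler_wpM2l.
  lra.
have vm0 : 0 < v ^+ m by rewrite exprn_gt0.
rewrite -(ler_pM2r vm0) mul1r; apply: le_trans max _.
have -> : 2 * K0 ^+ m.+1 * v * v ^+ m = (K0 * v) ^+ m.+1 * 2.
  by rewrite exprMn [v ^+ m.+1]exprS; ring.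
by apply: ler_pM; rewrite ?exprn_ge0 ?(ltW w0) // lerXn2r ?nnegrE // mulr_ge0 ?ltW.
Qed.
End Sets.

(** * Marginals of a measure restricted to a box *)

Section Box.
Context {R : realType}.
Variables (X Z Y : finType) (nu : X -> Z -> Y -> R).

Definition box_mass (A : {set X}) (C : {set Z}) (B : {set Y}) : R :=
  \sum_x \sum_z \sum_y nu x z y * ((x \in A)%:R * (z \in C)%:R * (y \in B)%:R).

Definition slice_mass (G : {set X * Z}) (H : {set Y}) : R :=
  \sum_x \sum_z \sum_y nu x z y * (((x, z) \in G)%:R * (y \in H)%:R).

(** Density, relative to the uniform weights, of the marginal of [nu] conditioned on the box. The
    coordinate summed out comes last, so the three marginals arise by permuting the arguments of
    [nu]. Outside the box the value is 0. *)
Definition box_density (A : {set X}) (C : {set Z}) (B : {set Y}) x z : R :=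
  (\sum_y nu x z y * ((x \in A)%:R * (z \in C)%:R * (y \in B)%:R)) /
  (box_mass A C B * uniform_on A x * uniform_on C z).

Lemma box_mass_ge0 A C B : (forall x z y, 0 <= nu x z y) -> 0 <= box_mass A C B.
Proof.
by move=> nu0; do 3!apply: sumr_ge0 => ? _; rewrite !mulr_ge0.
Qed.

Lemma box_massE A C B : box_mass A C B = slice_mass (setX A C) B.
Proof.
by do 3!apply: eq_bigr => ? _; rewrite in_setX -mulnb natrM.
Qed.

Lemma box_density_ge0 A C B x z : (forall x z y, 0 <= nu x z y) ->
  0 <= box_density A C B x z.
Proof.
move=> nu0; rewrite divr_ge0 //; first by apply: sumr_ge0 => y _; rewrite !mulr_ge0.
by rewrite !mulr_ge0 ?box_mass_ge0 // invr_ge0.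
Qed.

Lemma box_density_avg (A : {set X}) (C : {set Z}) (B : {set Y})
    (phi : X -> Z -> R) : 0 < box_mass A C B ->
  (0 < #|A|)%N -> (0 < #|C|)%N ->
  avg (uniform_on A) (fun x => avg (uniform_on C) (fun z =>
    box_density A C B x z * phi x z)) =
  (\sum_x \sum_z \sum_y
    nu x z y * ((x \in A)%:R * (z \in C)%:R * (y \in B)%:R) * phi x z)
    / box_mass A C B.
Proof.
move=> Q0 A0 C0; rewrite /avg mulr_suml; apply: eq_bigr => x _.
rewrite mulr_sumr mulr_suml; apply: eq_bigr => z _.
rewrite -mulr_suml /box_density; set N := \sum_y _.
have Qn0 : box_mass A C B != 0 by rewrite gt_eqF.
have [xA|xA] := boolP (x \in A); last first.
  have -> : N = 0 by apply: big1 => y _; rewrite (negbTE xA) !mul0r mulr0.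
  by rewrite !(mul0r, mulr0).
have [zC|zC] := boolP (z \in C); last first.
  have -> : N = 0 by apply: big1 => y _; rewrite (negbTE zC) mulr0 mul0r mulr0.
  by rewrite !(mul0r, mulr0).
rewrite /uniform_on xA zC; field.
by rewrite Qn0 !pnatr_eq0 -!lt0n A0 C0.
Qed.

Variables (A : {set X}) (C : {set Z}) (B : {set Y}).
Variables (K0 rho r0 s0 : R) (n : nat).
Let a := dens A + r0.
Let b := dens B + r0.
Let c := dens C + r0.
Let Q := box_mass A C B.

(** The box holds at least half its padded volume, so dividing the global slice bound by [Q] costs a
    constant factor; [s0 <= rho * (a * c)] turns the padding of slices into the relative padding
    [rho]. *)
Lemma box_spread : (forall x z y, 0 <= nu x z y) ->
  (forall G H, slice_mass G H <= K0 * (dens G + s0) * (dens H + s0)) ->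
  0 <= K0 -> 0 <= s0 -> s0 <= r0 -> s0 <= rho * (a * c) -> 0 < a * b * c ->
  a * b * c / 2 <= Q -> (0 < #|A|)%N -> (0 < #|C|)%N ->
  spread (uniform_on A) (uniform_on C) (box_density A C B) (4 * K0) rho.
Proof.
move=> nu0 S K00 s00 s0r0 s0rho v0 Qv A0 C0 P.
have Q0 : 0 < Q by apply: lt_le_trans Qv; lra.
rewrite box_density_avg // -/Q ler_pdivrMr //.
pose G := [set w : X * Z | [&& w.1 \in A, w.2 \in C & P w.1 w.2]].
have -> : \sum_x \sum_z \sum_y
    nu x z y * ((x \in A)%:R * (z \in C)%:R * (y \in B)%:R) * (P x z)%:R =
    slice_mass G B.
  by do 3!apply: eq_bigr => ? _; rewrite inE /= -!mulnb !natrM; ring.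
apply: le_trans (S _ _) _; rewrite -avg_uniform_on2 //; set t := avg _ _.
have t0 : 0 <= t 
  by apply: avg_ge0 => [x|x]; [|apply: avg_ge0 => [z|z]]; rewrite ?ler0n // divr_ge0.
have r00 : 0 <= r0 by apply: le_trans s0r0.
have dA : (0 : R) <= dens A := dens_ge0 A.
have dB : (0 : R) <= dens B := dens_ge0 B.
have dC : (0 : R) <= dens C := dens_ge0 C.
have a0 : 0 <= a by apply: addr_ge0.
have b0 : 0 <= b by apply: addr_ge0.
have c0 : 0 <= c by apply: addr_ge0.
have le1 : t * (dens A * dens C) + s0 <= (t + rho) * (a * c).
  have : t * (dens A * dens C) <= t * (a * c).
    by rewrite ler_wpM2l //; apply: ler_pM => //; rewrite lerDl.
  lra.
have le2 : dens B + s0 <= b by rewrite /b; lra.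
have lhs0 : 0 <= t * (dens A * dens C) + s0.
  by apply: addr_ge0 => //; apply: mulr_ge0 => //; apply: mulr_ge0.
have trho0 : 0 <= (t + rho) * (a * c).
  by apply: le_trans le1.
apply: (@le_trans _ _ (K0 * ((t + rho) * (a * c) * b))).
  by rewrite -mulrA ler_wpM2l //; apply: ler_pM => //; apply: addr_ge0.
have ac0 : 0 < a * c.
  rewrite lt_neqAle mulr_ge0 // andbT eq_sym; apply/eqP => e.
  by move: v0; rewrite mulrAC e mul0r ltxx.
have trho : 0 <= t + rho by rewrite pmulr_lge0 in trho0.
have : K0 * (t + rho) * (a * b * c) <= K0 * (t + rho) * (2 * Q).
  by rewrite ler_wpM2l ?mulr_ge0 //; lra.
have : 0 <= K0 * (t + rho) * Q by rewrite !mulr_ge0 // ltW.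
lra.
Qed.

Lemma box_extremal :
  (forall A' : {set X}, box_mass A' C B ^+ n * a ^+ n.-1 <=
    Q ^+ n * (dens A' + r0) ^+ n.-1) ->
  0 < Q -> 0 < r0 -> 0 < rho -> r0 <= rho * dens A -> (0 < #|A|)%N -> (0 < #|C|)%N ->
  extremal (uniform_on A) (fun x => avg (uniform_on C) (box_density A C B x)) rho n.
Proof.
move=> max Q0 r00 rho0 r0rho A0 C0 A'.
have dA : (0 : R) <= dens A := dens_ge0 A.
have a0 : 0 < a by rewrite /a; lra.
have -> : avg (uniform_on A) (fun x => avg (uniform_on C) (box_density A C B x) * (A' x)%:R)
    = box_mass [set x in A | A' x] C B / Q.
  under eq_avg do rewrite -avgZr.
  rewrite box_density_avg //; congr (_ / _); do 3!apply: eq_bigr => ? _.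
  by rewrite inE -mulnb natrM; ring.
set A1 := [set x in A | A' x]; set t := avg _ _.
have dE : t * dens A = dens A1 by apply: avg_uniform_on.
have t1 : t <= 1.
  rewrite -[leRHS](avg_cst 1 (uniform_on_prob A0)); apply: le_avg => [x|x].
    by rewrite divr_ge0.
  by case: (A' x).
have t0 : 0 <= t by apply: avg_ge0 => x //; rewrite divr_ge0.
apply: (@le_trans _ _ (((dens A1 + r0) / a) ^+ n.-1)).
  rewrite !expr_div_n ler_pdivrMr ?exprn_gt0 // mulrAC ler_pdivlMr ?exprn_gt0 //.
  by rewrite [leRHS]mulrC; apply: max.
have A10 := @dens_ge0 R _ A1.
rewrite lerXn2r ?nnegrE //.
- by apply: divr_ge0; lra.
- by apply: divr_ge0; lra.
rewrite ler_pdivrMr // mulrAC ler_pdivlMr; last by lra.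
rewrite -dE /a.
(* For t <= 1 the ratio (t + x) / (1 + x) increases with x, and r0 / dens A <= rho. *)
have : 0 <= (1 - t) * (rho * dens A - r0) by apply: mulr_ge0; lra.
lra.
Qed.

Lemma box_rect_extremal :
  (forall (A' : {set X}) (C' : {set Z}),
    box_mass A' C' B ^+ n * (a * c) ^+ n.-1 <=
    Q ^+ n * ((dens A' + r0) * (dens C' + r0)) ^+ n.-1) ->
  0 < Q -> 0 < r0 -> 0 <= rho -> r0 <= rho * dens A -> r0 <= rho * dens C ->
  (0 < #|A|)%N -> (0 < #|C|)%N ->
  rect_extremal (uniform_on A) (uniform_on C) (box_density A C B) rho n.
Proof.
move=> max Q0 r00 rho0 r0A r0C A0 C0 A' C'.
have dA : (0 : R) <= dens A := dens_ge0 A.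
have dC : (0 : R) <= dens C := dens_ge0 C.
have a0 : 0 < a by rewrite /a; lra.
have c0 : 0 < c by rewrite /c; lra.
rewrite box_density_avg //; set A1 := [set x in A | A' x]; set C1 := [set z in C | C' z].
have -> : \sum_x \sum_z \sum_y
    nu x z y * ((x \in A)%:R * (z \in C)%:R * (y \in B)%:R) * ((A' x)%:R * (C' z)%:R)
    = box_mass A1 C1 B.
  by do 3!apply: eq_bigr => ? _; rewrite !inE -!mulnb !natrM; ring.
set t := avg (uniform_on A) _; set w := avg (uniform_on C) _.
have tE : t * dens A = dens A1 by apply: avg_uniform_on.
have wE : w * dens C = dens C1 by apply: avg_uniform_on.
have t0 : 0 <= t by apply: avg_ge0 => x //; rewrite divr_ge0.
have w0 : 0 <= w by apply: avg_ge0 => x //; rewrite divr_ge0.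
have ac0 : 0 < a * c by rewrite mulr_gt0.
have A10 := @dens_ge0 R _ A1; have C10 := @dens_ge0 R _ C1.
apply: (@le_trans _ _ ((((dens A1 + r0) * (dens C1 + r0)) / (a * c)) ^+ n.-1)).
  rewrite !expr_div_n ler_pdivrMr ?exprn_gt0 // mulrAC ler_pdivlMr ?exprn_gt0 //.
  by rewrite [leRHS]mulrC; apply: max.
have rat0 : 0 <= (dens A1 + r0) * (dens C1 + r0) by apply: mulr_ge0; lra.
have ta : dens A1 + r0 <= (t + rho) * a.
  rewrite -tE /a; have : 0 <= (t + rho) * r0 by apply: mulr_ge0; lra.
  lra.
have wc : dens C1 + r0 <= (w + rho) * c.
  rewrite -wE /c; have : 0 <= (w + rho) * r0 by apply: mulr_ge0; lra.
  lra.
rewrite lerXn2r ?nnegrE //.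
- by rewrite divr_ge0 // ltW.
- by apply: mulr_ge0; lra.
rewrite ler_pdivrMr // mulrACA; apply: ler_pM => //; lra.
Qed.
End Box.

Lemma box_density_avg1 {R : realType} (X Z Y : finType) (nu : X -> Z -> Y -> R)
    (A : {set X}) (C : {set Z}) (B : {set Y}) :
  0 < box_mass nu A C B -> (0 < #|A|)%N -> (0 < #|C|)%N ->
  avg (uniform_on A) (fun x => avg (uniform_on C) (box_density nu A C B x)) = 1.
Proof.
move=> Q0 A0 C0; have := box_density_avg (fun _ _ => 1) Q0 A0 C0.
under eq_avg do under eq_avg do rewrite mulr1.
move=> ->; rewrite -[RHS](@divff _ (box_mass nu A C B)) ?gt_eqF //.
by congr (_ / _); do 3!apply: eq_bigr => ? _; rewrite mulr1.
Qed.

Lemma box_regular {R : realType} (X Z Y : finType) (nu : X -> Z -> Y -> R)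
    (A : {set X}) (C : {set Z}) (B : {set Y}) (rho beta : R) (p : nat)
    (r0 := beta * rho) (K0 := 2 ^+ p / 400 : R) (n := (20 * 100 * p)%N)
    (a := dens A + r0) (b := dens B + r0) (c := dens C + r0)
    (Q := box_mass nu A C B) :
  (forall x z y, 0 <= nu x z y) ->
  (forall G H, slice_mass nu G H <= K0 * (dens G + r0 ^+ 2) * (dens H + r0 ^+ 2)) ->
  0 < rho -> rho <= 1 -> 0 < beta -> beta <= 1 ->
  beta <= dens A -> beta <= dens C ->
  a * b * c / 2 <= Q ->
  (forall (A' : {set X}) (C' : {set Z}),
    box_mass nu A' C' B ^+ n * (a * c) ^+ n.-1 <=
    Q ^+ n * ((dens A' + r0) * (dens C' + r0)) ^+ n.-1) ->
  regular_density (uniform_on A) (uniform_on C) (box_density nu A C B) rho p.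
Proof.
move=> nu0 S rho0 rho1 beta0 beta1 bA bC Qv max.
have A0 : (0 < #|A|)%N by apply: (@dens_gt0 R); apply: lt_le_trans bA.
have C0 : (0 < #|C|)%N by apply: (@dens_gt0 R); apply: lt_le_trans bC.
have r00 : 0 < r0 by rewrite mulr_gt0.
have r01 : r0 <= 1 by rewrite /r0 mulr_ile1 // ltW.
have dB : (0 : R) <= dens B := dens_ge0 B.
have a0 : 0 < a by apply: ltr_wpDl => //; apply: dens_ge0.
have b0 : 0 < b by apply: ltr_wpDl.
have c0 : 0 < c by apply: ltr_wpDl => //; apply: dens_ge0.
have v0 : 0 < a * b * c by rewrite !mulr_gt0.
have Q0 : 0 < Q by apply: lt_le_trans Qv; rewrite divr_gt0.
have rA : r0 <= rho * dens A by rewrite /r0 mulrC ler_wpM2l // ltW.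
have rC : r0 <= rho * dens C by rewrite /r0 mulrC ler_wpM2l // ltW.
have K00 : 0 <= K0 by rewrite divr_ge0 // exprn_ge0.
have s0r : r0 ^+ 2 <= r0 by rewrite expr2 ler_piMr // ltW.
(* The slice padding is r0^2 because it must be below [rho] times an area whose two sides may both
   be tiny. *)
have s0a : r0 ^+ 2 <= rho * (a * c).
  have -> : r0 ^+ 2 = rho * (beta * r0) by rewrite /r0; ring.
  rewrite ler_wpM2l //; first exact: ltW.
  apply: ler_pM; rewrite ?(ltW beta0) ?(ltW r00) //.
    by rewrite /a; apply: le_trans bA _; rewrite lerDl ltW.
  by rewrite /c lerDr dens_ge0.
split.
- exact: uniform_on_prob.
- exact: uniform_on_prob.
- by move=> x z; apply: box_density_ge0.
- exact: box_density_avg1.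
- have -> : 2 ^+ p / 100 = 4 * K0 by rewrite /K0; field.
  by apply: (@box_spread _ _ _ _ nu A C B K0 rho r0 (r0 ^+ 2)) => //; exact: sqr_ge0.
- apply: (@box_extremal _ _ _ _ nu A C B rho r0) => //; move=> A'.
  have := max A' C; rewrite -/c !exprMn !mulrA ler_pM2r //.
  by rewrite exprn_gt0.
- by apply: (@box_rect_extremal _ _ _ _ nu A C B rho r0) => //; exact: ltW.
Qed.

(** * The extremal box and the dual statement *)

Lemma box_mass_perm132 {R : realType} (X Z Y : finType) (nu : X -> Y -> Z -> R)
    (A : {set X}) (C : {set Z}) (B : {set Y}) :
  box_mass (fun x z y => nu x y z) A C B = box_mass nu A B C.
Proof.
apply: eq_bigr => x _; rewrite exchange_big; do 2!apply: eq_bigr => ? _.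
by rewrite mulrAC.
Qed.

Lemma box_mass_perm231 {R : realType} (X Z Y : finType) (nu : X -> Y -> Z -> R)
    (A : {set X}) (C : {set Z}) (B : {set Y}) :
  box_mass (fun y z x => nu x y z) B C A = box_mass nu A B C.
Proof.
rewrite /box_mass [RHS]exchange_big; apply: eq_bigr => y _ /=.
rewrite [RHS]exchange_big; do 2!apply: eq_bigr => ? _ /=.
by ring.
Qed.

Lemma exists_extremal_box {R : realType} (X Y Z : finType) (nu : X -> Y -> Z -> R)
    (r0 : R) (n : nat) : 0 < r0 ->
  exists A B C, forall A' B' C',
    box_mass nu A' B' C' ^+ n *
      ((dens A + r0) * (dens B + r0) * (dens C + r0)) ^+ n.-1 <=
    box_mass nu A B C ^+ n *
      ((dens A' + r0) * (dens B' + r0) * (dens C' + r0)) ^+ n.-1.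
Proof.
move=> r00; pose v (w : {set X} * {set Y} * {set Z}) : R :=
  (dens w.1.1 + r0) * (dens w.1.2 + r0) * (dens w.2 + r0).
pose val w := box_mass nu w.1.1 w.1.2 w.2 ^+ n / v w ^+ n.-1.
have v0 w : 0 < v w ^+ n.-1.
  by rewrite exprn_gt0 // !mulr_gt0 // ltr_wpDl // dens_ge0.
have [w _ wmax] := @arg_maxP _ R _ (set0, set0, set0) xpredT val erefl.
exists w.1.1, w.1.2, w.2 => A' B' C'.
have := wmax (A', B', C') erefl; rewrite /val /=.
by rewrite ler_pdivrMr // mulrAC ler_pdivlMr.
Qed.

(** A lower bound on the volume passes to each side, the other two having product at most 2. The
    division by 400 provides the leading factor 2, which leaves room to subtract the padding [r0]
    afterwards. *)
Lemma side_ge {R : realType} (p n : nat) (a w : R) : (0 < n)%N -> 0 <= a ->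
  w <= 2 -> 1 <= 2 * (2 ^+ p / 400) ^+ n * (a * w) -> 2 * (2 ^+ (n * p))^-1 <= a.
Proof.
move=> n0 a0 w2 h; have P0 : (0 : R) < 2 ^+ (n * p) by rewrite exprn_gt0.
have k0 : 0 <= (2 ^+ p / 400 : R) ^+ n by rewrite exprn_ge0 // divr_ge0 // exprn_ge0.
have kle : (2 ^+ p / 400 : R) ^+ n <= 2 ^+ (n * p) / 8.
  rewrite expr_div_n -exprM mulnC ler_wpM2l ?(ltW P0) //.
  have h400 : (8 : R) <= 400 ^+ n.
    case: n n0 {h P0 k0} => // m _; rewrite exprS.
    have : (1 : R) <= 400 ^+ m by apply: exprn_ege1; lra.
    lra.
  by rewrite lef_pV2 // posrE; lra.
have h1 : 2 * (2 ^+ p / 400) ^+ n * (a * w) <= 2 * (2 ^+ p / 400) ^+ n * (a * 2).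
  by rewrite ler_wpM2l ?mulr_ge0 // ler_wpM2l.
have h2 : (2 ^+ p / 400) ^+ n * a <= 2 ^+ (n * p) / 8 * a by rewrite ler_wpM2r.
rewrite ler_pdivrMr // ; lra.
Qed.

Lemma uniform_on_triple_le {R : realType} (X Y Z : finType) (F : X -> Y -> Z -> R)
    (A : {set X}) (B : {set Y}) (C : {set Z}) :
  (0 < #|A|)%N -> (0 < #|B|)%N -> (0 < #|C|)%N ->
  (forall x y z, 0 <= F x y z) ->
  avg (uniform_on A) (fun x => avg (uniform_on B) (fun y =>
    avg (uniform_on C) (F x y))) * (dens A * dens B * dens C) <=
  expectation (fun w : X * Y * Z => F w.1.1 w.1.2 w.2).
Proof.
move=> A0 B0 C0 F0.
rewrite /expectation !card_prod !natrM.
have -> : dens A * dens B * dens C =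
    (#|A|%:R * #|B|%:R * #|C|%:R) / (#|X|%:R * #|Y|%:R * #|Z|%:R) :> R.
  by rewrite /dens !invfM; ring.
rewrite mulrA ler_wpM2r ?invr_ge0 ?mulr_ge0 //.
rewrite -(pair_bigA _ (fun u z => F u.1 u.2 z)) /=.
rewrite -(pair_bigA _ (fun x y => \sum_z F x y z)) /=.
rewrite /avg mulr_suml; apply: ler_sum => x _.
rewrite mulr_sumr mulr_suml; apply: ler_sum => y _.
rewrite mulr_sumr mulr_sumr mulr_suml; apply: ler_sum => z _.
rewrite /uniform_on.
have -> : (x \in A)%:R / #|A|%:R * ((y \in B)%:R / #|B|%:R *
    ((z \in C)%:R / #|C|%:R * F x y z)) * (#|A|%:R * #|B|%:R * #|C|%:R) =
    ((x \in A)%:R * (y \in B)%:R * (z \in C)%:R) * F x y z.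
  by field; rewrite !pnatr_eq0 -!lt0n A0 B0 C0.
rewrite ler_piMl //.
by case: (x \in A); case: (y \in B); case: (z \in C);
  rewrite /= ?mulr0 ?mul0r ?mulr1 ?ler01 ?lexx.
Qed.

Lemma truncate_box_density_le {R : realType} (X Z Y : finType)
    (nu : X -> Z -> Y -> R) (A : {set X}) (C : {set Z}) (B : {set Y})
    (L : R) (P : X -> Z -> bool) x z :
  0 <= L -> (forall x z y, 0 <= nu x z y) ->
  (forall x z y, ~~ P x z -> nu x z y = 0) ->
  0 <= truncate (box_density nu A C B) L x z <= L * (P x z)%:R.
Proof.
move=> L0 nu0 supp; rewrite /truncate le_min L0 box_density_ge0 //=.
have [h|h] := boolP (P x z); first by rewrite mulr1 ge_min lexx orbT.
rewrite mulr0 ge_min /box_density big1 ?mul0r ?lexx // => y _.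
by rewrite supp // mul0r.
Qed.

(** Each side of the extremal box has density at least 2^(-n p). Inside it the truncated densities
    are at most L = 2^p / 50 times the indicators [f], [g], [h], so the triangle count 1/4 gives
    density at least 1 / (4 L^3) >= 2^(-3p). *)
Lemma spread_measure_dense {R : realType} (X Y Z : finType)
    (f : X -> Y -> bool) (g : X -> Z -> bool) (h : Y -> Z -> bool)
    (nu : X -> Y -> Z -> R) (p : nat)
    (n := (20 * 100 * p)%N) (r0 := (2 ^+ (n * p + 24 * (13 * p + 1) * p))^-1 : R)
    (K0 := 2 ^+ p / 400 : R) :
  (24 <= p)%N -> ~~ odd p -> (0 < #|X|)%N -> (0 < #|Y|)%N -> (0 < #|Z|)%N ->
  (forall x y z, 0 <= nu x y z) -> \sum_x \sum_y \sum_z nu x y z = 1 ->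
  (forall x y z, ~~ [&& f x y, g x z & h y z] -> nu x y z = 0) ->
  (forall G H, slice_mass nu G H <= K0 * (dens G + r0 ^+ 2) * (dens H + r0 ^+ 2)) ->
  (forall G H, slice_mass (fun x z y => nu x y z) G H <=
     K0 * (dens G + r0 ^+ 2) * (dens H + r0 ^+ 2)) ->
  (forall G H, slice_mass (fun y z x => nu x y z) G H <=
     K0 * (dens G + r0 ^+ 2) * (dens H + r0 ^+ 2)) ->
  (2 ^+ (3 * (n * p) + 3 * p))^-1 <= expectation (cylinder_intersection R f g h).
Proof.
move=> p24 pE X0 Y0 Z0 nu0 nu1 supp Sxy Sxz Syz.
pose beta : R := (2 ^+ (n * p))^-1.
pose rho : R := (2 ^+ (24 * (13 * p + 1) * p))^-1.
have r0E : r0 = beta * rho by rewrite /r0 /beta /rho exprD invfM.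
have inv1 m : ((2 : R) ^+ m)^-1 <= 1.
  by rewrite invf_le1 ?exprn_gt0 // exprn_ege1 //; clear; lra.
have inv0 m : 0 < ((2 : R) ^+ m)^-1 by rewrite invr_gt0 exprn_gt0.
have beta0 : 0 < beta := inv0 _.
have beta1 : beta <= 1 := inv1 _.
have rho0 : 0 < rho := inv0 _.
have rho1 : rho <= 1 := inv1 _.
have r00 : 0 < r0 := inv0 _.
have r0b : r0 <= beta by rewrite r0E ler_piMr // ltW.
have rho_small : rho * 2 ^+ (24 * (13 * p + 1) * p) <= 1.
  by rewrite /rho mulVf // gt_eqF // exprn_gt0.
have betaE : beta = (2 ^+ (n * p))^-1 by [].
have r01 : r0 <= 1 := inv1 _.
clearbody r0 beta rho.
have n0 : (0 < n)%N by rewrite /n; clear -p24; lia.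
have [A [B [C max]]] := @exists_extremal_box R X Y Z nu r0 n r00.
set a := dens A + r0 in max; set b := dens B + r0 in max; set c := dens C + r0 in max.
have dle (T : finType) (S : {set T}) : r0 <= dens S + r0 <= 1 + r0.
  by rewrite lerDr dens_ge0 lerD2r dens_le1.
have /andP[a0' a1] := dle _ A; have /andP[b0' b1] := dle _ B.
have /andP[c0' c1] := dle _ C; rewrite -/a in a0' a1; rewrite -/b in b0' b1.
rewrite -/c in c0' c1.
have a0 : 0 < a := lt_le_trans r00 a0'.
have b0 : 0 < b := lt_le_trans r00 b0'.
have c0 : 0 < c := lt_le_trans r00 c0'.
set Q := box_mass nu A B C in max.
have Qge0 : 0 <= Q by apply: box_mass_ge0.
(* The padding inflates the volume of the whole space to (1 + r0)^3; this keeps even its [n]-th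
   power below 2. *)
have w3n : (1 + r0) ^+ (3 * n) <= 2.
  have r0n : (3 * n)%:R * r0 <= 1 / 2.
    apply: (@le_trans _ _ ((3 * n)%:R * beta)); first by rewrite ler_wpM2l.
    rewrite betaE ler_pdivrMr ?exprn_gt0 //.
    have := @expr2_ge R (n * p); rewrite (natrM R n p) (natrM R 3 n).
    have : (24 : R) <= p%:R by rewrite (ler_nat R 24 p).
    move=> h24; have : (n%:R : R) * 24 <= n%:R * p%:R by rewrite ler_wpM2l.
    have : (0 : R) <= n%:R by [].
    clear; lra.
  apply: le_trans (le_expr1D (ltW r00) r0n) _; clear -r0n; lra.
pose w := (1 + r0) ^+ 3.
have r1 : 1 <= 1 + r0 by rewrite lerDl ltW.
have w0 : 0 < w by rewrite exprn_gt0 //; clear -r1; lra.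
have w2 : w <= 2.
  by apply: le_trans w3n; rewrite ler_weXn2l //; clear -n0; lia.
have wn : w ^+ n.-1 <= 2.
  by apply: le_trans w3n; rewrite /w -exprM ler_weXn2l //; clear -n0; lia.
have vw : a * b * c <= w.
  rewrite /w !exprS expr0 mulr1 mulrA.
  by do 2!(apply: ler_pM => //; rewrite ?mulr_ge0 ?(ltW a0) ?(ltW b0) ?(ltW c0) //).
have v0 : 0 < a * b * c by rewrite !mulr_gt0.
have K00 : 0 < K0 by rewrite divr_gt0 // exprn_gt0.
have QK : Q <= K0 * (a * b * c).
  rewrite /Q box_massE; apply: le_trans (Sxy _ _) _.
  rewrite -[leLHS]mulrA ler_wpM2l //; first exact: ltW.
  have r02 : r0 ^+ 2 <= r0 by rewrite expr2 ler_piMr // ltW.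
  have dA : (0 : R) <= dens A := dens_ge0 A.
  have dB : (0 : R) <= dens B := dens_ge0 B.
  have dC : (0 : R) <= dens C := dens_ge0 C.
  apply: ler_pM; rewrite ?addr_ge0 ?sqr_ge0 ?dens_ge0 //; last by rewrite lerD2l.
  rewrite densX /a /b.
  have h1 : 0 <= dens A * r0 by apply: mulr_ge0 => //; exact: ltW.
  have h2 : 0 <= r0 * dens B by apply: mulr_ge0 => //; exact: ltW.
  by rewrite mulrDl !mulrDr expr2; clear -h1 h2; lra.
have maxT : (a * b * c) ^+ n.-1 <= Q ^+ n * w ^+ n.-1.
  have := max [set: X] [set: Y] [set: Z].
  rewrite !densT //.
  have -> : box_mass nu [set: X] [set: Y] [set: Z] = 1.
    by rewrite -nu1; do 3!apply: eq_bigr => ? _; rewrite !inE !mulr1.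
  by rewrite expr1n mul1r /w !exprS expr0 mulr1 mulrA.
have [Qv vK] := extremal_box_bounds n0 K00 v0 Qge0 w0 w2 wn vw QK maxT.
have w12 : (1 + r0) * (1 + r0) <= 2.
  by apply: le_trans w2; rewrite /w -expr2 ler_weXn2l.
have two (u v : R) : 0 <= u -> 0 <= v -> u <= 1 + r0 -> v <= 1 + r0 -> u * v <= 2.
  by move=> *; apply: le_trans w12; apply: ler_pM.
have side (u v : R) : 0 <= u -> v <= 2 -> u * v = a * b * c -> 2 * beta <= u.
  by move=> u0 v2 uv; rewrite betaE; apply: (side_ge n0 u0 v2); rewrite uv.
have bA : beta <= dens A.
  have := side a (b * c) (ltW a0) (two _ _ (ltW b0) (ltW c0) b1 c1) (mulrA _ _ _).
  by rewrite /a; clear -r0b; lra.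
have bB : beta <= dens B.
  have := side b (a * c) (ltW b0) (two _ _ (ltW a0) (ltW c0) a1 c1).
  by rewrite mulrCA mulrA => /(_ erefl); rewrite /b; clear -r0b; lra.
have bC : beta <= dens C.
  have := side c (a * b) (ltW c0) (two _ _ (ltW a0) (ltW b0) a1 b1) (mulrC _ _).
  by rewrite /c; clear -r0b; lra.
have A0 : (0 < #|A|)%N by apply: (@dens_gt0 R); apply: lt_le_trans bA.
have B0 : (0 < #|B|)%N by apply: (@dens_gt0 R); apply: lt_le_trans bB.
have C0 : (0 < #|C|)%N by apply: (@dens_gt0 R); apply: lt_le_trans bC.
have Q0 : 0 < Q by apply: lt_le_trans Qv; rewrite divr_gt0.
pose df := box_density nu A B C.
pose dg := box_density (fun x z y => nu x y z) A C B.
pose dh := box_density (fun y z x => nu x y z) B C A.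
have regf : regular_density (uniform_on A) (uniform_on B) df rho p.
  apply: (@box_regular R X Y Z nu A B C rho beta p) => //; rewrite -?r0E //.
  - by rewrite -/a -/b -/c [a * c * b]mulrAC.
  - move=> A' B'; rewrite -/a -/b -/Q.
    have := max A' B' C; rewrite -/c !exprMn !mulrA ler_pM2r //.
    by rewrite exprn_gt0.
have regg : regular_density (uniform_on A) (uniform_on C) dg rho p.
  apply: (@box_regular R X Z Y (fun x z y => nu x y z) A C B rho beta p) => //;
    rewrite -?r0E //.
  - by rewrite (box_mass_perm132 nu); exact: Qv.
  - move=> A' C'; rewrite !(box_mass_perm132 nu) -/a -/c -/Q.
    have := max A' B C'; rewrite -/b ![_ * b]mulrC -![b * _ * _]mulrA ![(b * _) ^+ _]exprMn.
    by rewrite !(mulrCA _ (b ^+ _)) ler_pM2l // exprn_gt0.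
have regh : regular_density (uniform_on B) (uniform_on C) dh rho p.
  apply: (@box_regular R Y Z X (fun y z x => nu x y z) B C A rho beta p) => //;
    rewrite -?r0E //.
  - by rewrite (box_mass_perm231 nu) -/a -/b -/c [b * a]mulrC.
  - move=> B' C'; rewrite !(box_mass_perm231 nu) -/b -/c -/Q.
    have := max A B' C'; rewrite -/a -![a * _ * _]mulrA ![(a * _) ^+ _]exprMn.
    by rewrite !(mulrCA _ (a ^+ _)) ler_pM2l // exprn_gt0.
have := truncated_triangle_ge p24 pE rho0 rho_small (rd_ge0 regf) (rd_avg regf)
  (rd_spread regf) regg regh.
set L : R := 2 * _; move=> Tge.
have L0 : 0 <= L by rewrite mulr_ge0 // divr_ge0 // exprn_ge0.
pose F x y z : R := (f x y)%:R * ((g x z)%:R * (h y z)%:R).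
have F0 x y z : 0 <= F x y z by rewrite !mulr_ge0.
set T := avg _ _ in Tge.
have TF : T <= L ^+ 3 * avg (uniform_on A) (fun x => avg (uniform_on B) (fun y =>
    avg (uniform_on C) (F x y))).
  rewrite -avgZ; apply: le_avg => [x|x]; first exact: (rd_probX regf).1.
  rewrite -avgZ; apply: le_avg => [y|y]; first exact: (rd_probZ regf).1.
  rewrite -avgZ; apply: le_avg => [z|z]; first exact: (rd_probZ regg).1.
  have /andP[f0 f1] : 0 <= truncate df L x y <= L * (f x y)%:R.
    apply: truncate_box_density_le => // x' y' z' nf.
    by apply: supp; rewrite (negbTE nf).
  have /andP[g0 g1] : 0 <= truncate dg L x z <= L * (g x z)%:R.
    apply: truncate_box_density_le => // x' z' y' ng.
    by apply: supp; rewrite (negbTE ng) andbF.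
  have /andP[h0 h1] : 0 <= truncate dh L y z <= L * (h y z)%:R.
    apply: truncate_box_density_le => // y' z' x' nh.
    by apply: supp; rewrite (negbTE nh) !andbF.
  have -> : L ^+ 3 * F x y z = (L * (f x y)%:R) * ((L * (g x z)%:R) * (L * (h y z)%:R)).
    by rewrite /F; ring.
  by apply: ler_pM => //; [rewrite mulr_ge0 | apply: ler_pM].
have := uniform_on_triple_le A0 B0 C0 F0.
have -> : expectation (fun w : X * Y * Z => F w.1.1 w.1.2 w.2) =
    expectation (cylinder_intersection R f g h).
  rewrite /expectation; congr (_ / _); apply: eq_bigr => -[[x y] z] _.
  by rewrite /F /= mulrA.
apply: le_trans; move: TF; set S := avg _ _ => TF.
have S0 : 0 <= S.
  apply: avg_ge0 => [x|x]; first exact: (rd_probX regf).1.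
  apply: avg_ge0 => [y|y]; first exact: (rd_probZ regf).1.
  by apply: avg_ge0 => [z|z]; first exact: (rd_probZ regg).1.
have P0 : (0 : R) < 2 ^+ p ^+ 3 by rewrite !exprn_gt0.
have SP : (2 ^+ p ^+ 3)^-1 <= S.
  rewrite -div1r ler_pdivrMr // mulrC.
  have LE : L ^+ 3 * S = (2 / 100) ^+ 3 * (2 ^+ p ^+ 3 * S) by rewrite /L; field.
  have PS0 : 0 <= 2 ^+ p ^+ 3 * S by rewrite mulr_ge0 // ltW.
  have c3 : (2 / 100 : R) ^+ 3 <= 1 / 4 by rewrite !exprS expr0; clear; lra.
  have := ler_wpM2r PS0 c3; rewrite -LE; clear -TF Tge; lra.
have -> : (2 ^+ (3 * (n * p) + 3 * p))^-1 = (2 ^+ p ^+ 3)^-1 * (beta * beta * beta) :> R.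
  rewrite betaE -!invfM -!exprD -exprM -exprD; congr (_ ^+ _)^-1.
  by clear; lia.
have bb : 0 <= beta * beta by rewrite mulr_ge0 // ltW.
have b_ge0 := ltW beta0.
apply: ler_pM => //; first by rewrite invr_ge0 ltW.
  by rewrite mulr_ge0.
by apply: ler_pM => //; apply: ler_pM.
Qed.

(** * Covers by multiplicative weights, and padding of slices *)

Lemma exists_expr_gt {R : realType} (c : R) :
  exists2 M : nat, (0 < M)%N & c * 2 ^+ M < 3 ^+ M.
Proof.
have [M cM] : exists M : nat, 2 * `|c| < M%:R.
  by exists (Num.bound (2 * `|c|)); apply: archi_boundP; rewrite mulr_ge0.
exists M.
  by rewrite lt0n; apply: contraTneq cM => ->; rewrite -leNgt mulr_ge0.
have -> : (3 : R) ^+ M = (1 + 1 / 2) ^+ M * 2 ^+ M.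
  by rewrite -exprMn; congr (_ ^+ _); lra.
rewrite ltr_pM2r ?exprn_gt0 //.
have h0 : (0 : R) <= 1 / 2 by lra.
have := bernoulli M h0; have := ler_norm c; lra.
Qed.

(* Multiplicative weights: the measure [nu] is proportional to [2 ^- N], where [N w]
   counts the sets chosen so far that contain [w]. *)
Lemma fractional_cover {R : realType} (T : finType) (F : pred T)
    (S : {set T} -> Prop) (K sigma : R) : 0 < K -> 0 < sigma ->
  (forall s, S s -> sigma <= dens s) ->
  (forall nu : T -> R, (forall w, 0 <= nu w) -> \sum_w nu w = 1 ->
     (forall w, ~~ F w -> nu w = 0) ->
     exists2 s, S s & K * dens s <= \sum_w nu w * (w \in s)%:R) ->
  exists (l : seq {set T}) (M : nat),
    [/\ (0 < M)%N, forall s, s \in l -> S s,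
        forall w, F w -> (M <= count (fun s : {set T} => w \in s) l)%N &
        \sum_(s <- l) dens s <= 4 / K * M%:R].
Proof.
move=> K0 sg0 Ssg H.
pose mass (l : seq {set T}) : R := \sum_(s <- l) dens s.
pose N (l : seq {set T}) w := count (fun s : {set T} => w \in s) l.
pose Phi l : R := \sum_w (F w)%:R * (2^-1) ^+ N l w.
have [M M0 Mbig] := exists_expr_gt (#|T|%:R * expR (K / 2) : R).
pose covered l := forall w, F w -> (M <= N l w)%N.
(* A set [s] supplied by [H] multiplies [Phi] by at most 1 - (K/2) dens s <= exp(-(K/2) dens s), so
   the product never grows. *)
pose inv l := (forall s, s \in l -> S s) /\
  Phi l * expR (K / 2 * mass l) <= #|T|%:R.
have half0 k : (0 : R) < 2^-1 ^+ k by rewrite exprn_gt0 // invr_gt0.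
(* An uncovered point forces Phi >= 2^(-M), hence exp((K/2) mass) <= #|T| 2^M. By the choice of [M]
   and exp 2 >= 3, there is room for one more set, of density at most 1. *)
have small l : inv l -> ~ covered l -> 0 < Phi l /\ mass l + 1 <= 4 / K * M%:R.
  move=> [_ Pl] nc.
  have [w Fw Nw] : exists2 w, F w & (N l w < M)%N.
    have [//|no] := pselect (exists2 w, F w & (N l w < M)%N).
    by case: nc => w Fw; rewrite leqNgt; apply/negP => h; apply: no; exists w.
  have PhiM : (2^-1) ^+ M <= Phi l.
    rewrite /Phi (bigD1 w) //= Fw mul1r -[leLHS]addr0 lerD //.
      by apply: ler_wiXn2l; [clear; lra | clear; lra | exact: ltnW].
    by apply: sumr_ge0 => w' _; rewrite mulr_ge0 // ltW.
  split; first exact: lt_le_trans PhiM.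
  rewrite leNgt; apply/negP => big.
  have e1 : 2 * M%:R <= K / 2 * mass l + K / 2.
    have : K / 2 * (4 / K * M%:R) <= K / 2 * (mass l + 1).
      by rewrite ler_wpM2l ?ltW // divr_gt0.
    have -> : K / 2 * (4 / K * M%:R) = 2 * M%:R by field; rewrite gt_eqF.
    clear; lra.
  have e2 : (3 : R) ^+ M <= expR (K / 2 * mass l) * expR (K / 2).
    rewrite -expRD; apply: (@le_trans _ _ (expR (2 * M%:R))); last by rewrite ler_expR.
    rewrite mulrC expRM_natl lerXn2r ?nnegrE ?expR_ge0 //.
    have := expR_ge1Dx (2 : R); clear; lra.
  have e3 : expR (K / 2 * mass l) <= #|T|%:R * 2 ^+ M.
    rewrite -ler_pdivrMr ?exprn_gt0 // mulrC.
    apply: le_trans Pl; rewrite ler_wpM2r ?expR_ge0 //.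
    by rewrite -exprVn.
  have e4 : expR (K / 2 * mass l) * expR (K / 2) <= #|T|%:R * expR (K / 2) * 2 ^+ M.
    by rewrite [leRHS]mulrAC ler_wpM2r ?expR_ge0.
  by have := le_lt_trans (le_trans e2 e4) Mbig; rewrite ltxx.
have step l : inv l -> 0 < Phi l -> exists2 s, S s & inv (s :: l).
  move=> [Sl Pl] Phi0; pose nu w := (F w)%:R * 2^-1 ^+ N l w / Phi l.
  have nu0 w : 0 <= nu w.
    by rewrite /nu; apply: divr_ge0; [rewrite mulr_ge0 // ltW | exact: ltW].
  have nu1 : \sum_w nu w = 1 by rewrite -mulr_suml divff // gt_eqF.
  have nuF w : ~~ F w -> nu w = 0 by move=> nF; rewrite /nu (negbTE nF) !mul0r.
  have [s Ss sK] := H nu nu0 nu1 nuF; exists s => //; split.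
    by move=> s'; rewrite inE => /predU1P[->//|/Sl].
  have PhiE : Phi (s :: l) = Phi l * (1 - 2^-1 * \sum_w nu w * (w \in s)%:R).
    rewrite mulrBr mulr1 mulr_sumr mulr_sumr -sumrB; apply: eq_bigr => w _.
    have -> : N (s :: l) w = ((w \in s) + N l w)%N by [].
    have Pn0 : Phi l != 0 by rewrite gt_eqF.
    rewrite exprD /nu; move: (N l w) => k; case: (w \in s);
      rewrite ?expr1 ?expr0 ?mulr1 ?mulr0; by field.
  apply: le_trans Pl; rewrite PhiE.
  have -> : mass (s :: l) = dens s + mass l by rewrite /mass big_cons.
  rewrite (mulrDr (K / 2)) expRD.
  set e := \sum_w _ in sK *; set x := K / 2 * dens s.
  have x_le : 1 - 2^-1 * e <= expR (- x).
    apply: le_trans (expR_ge1Dx (- x)); rewrite /x; clear -sK; lra.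
  have -> : Phi l * (1 - 2^-1 * e) * (expR x * expR (K / 2 * mass l)) =
    (Phi l * expR (K / 2 * mass l)) * ((1 - 2^-1 * e) * expR x) by ring.
  apply: ler_piMr; first by rewrite mulr_ge0 ?expR_ge0 // ltW.
  have := ler_wpM2r (expR_ge0 x) x_le.
  by rewrite -expRD addNr expR0.
have iter j : exists l, [/\ inv l, mass l <= 4 / K * M%:R & covered l \/ size l = j].
  elim: j => [|j [l [il ml cl]]].
    exists [::]; split; last by right.
    - split=> //; rewrite /mass big_nil mulr0 expR0 mulr1 /Phi.
      rewrite -sum1_card natr_sum; apply: ler_sum => w _.
      by rewrite /= expr0 mulr1; case: (F w).
    - by rewrite /mass big_nil mulr_ge0 // divr_ge0 // ltW.
  have [c|nc] := pselect (covered l); first by exists l; split=> //; left.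
  have [Phi0 ml1] := small l il nc.
  have [s Ss isl] := step l il Phi0.
  exists (s :: l); split=> //; last by case: cl => [//|<-]; right.
  rewrite /mass big_cons; have := @dens_le1 R _ s; rewrite -/(mass l); clear -ml1; lra.
(* Every chosen set adds at least [sigma] to the bounded mass, so the process stops. *)
have [j jbig] : exists j : nat, 4 / K * M%:R / sigma < j%:R.
  exists (Num.bound (4 / K * M%:R / sigma)); apply: archi_boundP.
  by rewrite !mulr_ge0 // ?invr_ge0 ltW.
have [l [[Sl _] ml cl]] := iter j.
exists l, M; split=> //; case: cl => // szl.
exfalso; move: jbig; rewrite ltNge => /negP; apply.
rewrite ler_pdivlMr //; apply: le_trans ml; rewrite -szl /mass.
elim: l Sl {szl} => [|s l IH] Sl; first by rewrite big_nil mul0r.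
rewrite big_cons /= -natr1 mulrDl mul1r addrC lerD //.
  by apply: Ssg; apply: Sl; rewrite mem_head.
by apply: IH => s' s'l; apply: Sl; rewrite inE s'l orbT.
Qed.

(** A maximal superset of density below [s] is enlarged by one point, which costs 1 / #|T|, at most
    [dens G] because [G] is nonempty. *)
Lemma pad_set {R : realType} (T : finType) (G : {set T}) (s : R) :
  (0 < #|G|)%N -> 0 <= s <= 1 ->
  exists2 G' : {set T}, G \subset G' & s <= dens G' <= dens G + s.
Proof.
move=> G0 /andP[s0 s1].
have [le|lt] := leP s (dens G); first by exists G => //; rewrite le lerDl.
have T0 : (0 < #|T|)%N by apply: leq_trans G0 (max_card _).
have [G1 /maxsetP[lt1 max] GG1] := @maxset_exists T (fun A => dens A < s) G lt.
have [x xG1] : exists x, x \notin G1.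
  apply/existsP; rewrite -negb_forall; apply/negP => /forallP all.
  have e : G1 = [set: T] by apply/setP => x; rewrite inE all.
  by move: lt1; rewrite e densT // ltNge s1.
exists (x |: G1); first by apply: subset_trans GG1 (subsetUr _ _).
apply/andP; split.
  rewrite leNgt; apply/negP => h; have e := max _ h (subsetUr _ _).
  by move: xG1; rewrite -e setU11.
have -> : dens (x |: G1) = dens G1 + #|T|%:R^-1 :> R.
  by rewrite /dens cardsU1 xG1 natrD mulrDl mul1r addrC.
rewrite addrC lerD ?(ltW lt1) // /dens -[leLHS]mul1r ler_wpM2r ?invr_ge0 //.
by rewrite ler1n.
Qed.

(** Padding both factors to density at least [s] brings the slice above the threshold s^2 of the
    hypothesis; slices with an empty factor have mass 0. *)
Lemma slice_mass_le_padded {R : realType} (X Z Y : finType) (nu : X -> Z -> Y -> R)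
    (K s : R) : 0 <= K -> 0 <= s <= 1 -> (forall x z y, 0 <= nu x z y) ->
  (forall G H, s ^+ 2 <= dens G * dens H -> slice_mass nu G H <= K * (dens G * dens H)) ->
  forall G H, slice_mass nu G H <= K * (dens G + s) * (dens H + s).
Proof.
move=> K0 s01 nu0 big G H; have /andP[s0 s1] := s01.
have rhs0 : 0 <= K * (dens G + s) * (dens H + s).
  by rewrite !mulr_ge0 // addr_ge0 // dens_ge0.
have [/eqP|G0] := posnP #|G|.
  rewrite cards_eq0 => /eqP G0; rewrite [slice_mass _ _ _]big1 // => x _.
  by do 2!(rewrite big1 // => ? _); rewrite G0 inE mul0r mulr0.
have [/eqP|H0] := posnP #|H|.
  rewrite cards_eq0 => /eqP H0; rewrite [slice_mass _ _ _]big1 // => x _.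
  by do 2!(rewrite big1 // => ? _); rewrite H0 inE !mulr0.
have [G' GG' /andP[G1 G2]] := pad_set G0 s01.
have [H' HH' /andP[H1 H2]] := pad_set H0 s01.
apply: (@le_trans _ _ (slice_mass nu G' H')).
  do 3!apply: ler_sum => ? _; rewrite ler_wpM2l // -!natrM ler_nat !mulnb.
  case: (boolP (_ \in G)) => //= hG; rewrite (subsetP GG' _ hG) /=.
  by case: (boolP (_ \in H)) => //= hH; rewrite (subsetP HH' _ hH).
apply: le_trans (big G' H' _) _; first by rewrite expr2; apply: ler_pM.
by rewrite -[leRHS]mulrA ler_wpM2l //; apply: ler_pM; rewrite ?dens_ge0.
Qed.

(** * Slices as sets and as functions *)

Section Slices.
Context {R : realType} {X Y Z : finType}.
Implicit Type s : {set X * Y * Z}.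

Definition slice_xy (G : {set X * Y}) (H : {set Z}) : {set X * Y * Z} :=
  [set w | (w.1 \in G) && (w.2 \in H)].
Definition slice_xz (G : {set X * Z}) (H : {set Y}) : {set X * Y * Z} :=
  [set w | ((w.1.1, w.2) \in G) && (w.1.2 \in H)].
Definition slice_yz (G : {set Y * Z}) (H : {set X}) : {set X * Y * Z} :=
  [set w | ((w.1.2, w.2) \in G) && (w.1.1 \in H)].

Definition is_slice s : Prop :=
  [\/ exists G H, s = slice_xy G H, exists G H, s = slice_xz G H
    | exists G H, s = slice_yz G H].

Lemma sum_tripleE (F : X -> Y -> Z -> R) :
  \sum_(w : X * Y * Z) F w.1.1 w.1.2 w.2 = \sum_x \sum_y \sum_z F x y z.
Proof.
rewrite -(pair_bigA _ (fun u z => F u.1 u.2 z)) /=.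
by rewrite -(pair_bigA _ (fun x y => \sum_z F x y z)).
Qed.

Lemma sum_slice_xy (nu : X -> Y -> Z -> R) G H :
  \sum_w nu w.1.1 w.1.2 w.2 * (w \in slice_xy G H)%:R = slice_mass nu G H.
Proof.
apply: etrans _ (sum_tripleE (fun x y z => nu x y z * (((x, y) \in G)%:R * (z \in H)%:R))).
by apply: eq_bigr => -[[x y] z] _; rewrite inE -mulnb natrM.
Qed.

Lemma sum_slice_xz (nu : X -> Y -> Z -> R) G H :
  \sum_w nu w.1.1 w.1.2 w.2 * (w \in slice_xz G H)%:R =
  slice_mass (fun x z y => nu x y z) G H.
Proof.
rewrite /slice_mass; under [RHS]eq_bigr do rewrite exchange_big /=.
apply: etrans _ (sum_tripleE (fun x y z => nu x y z * (((x, z) \in G)%:R * (y \in H)%:R))).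
by apply: eq_bigr => -[[x y] z] _; rewrite inE -mulnb natrM.
Qed.

Lemma sum_slice_yz (nu : X -> Y -> Z -> R) G H :
  \sum_w nu w.1.1 w.1.2 w.2 * (w \in slice_yz G H)%:R =
  slice_mass (fun y z x => nu x y z) G H.
Proof.
rewrite /slice_mass; under [RHS]eq_bigr do rewrite exchange_big /=.
rewrite [RHS]exchange_big.
apply: etrans _ (sum_tripleE (fun x y z => nu x y z * (((y, z) \in G)%:R * (x \in H)%:R))).
by apply: eq_bigr => -[[x y] z] _; rewrite inE -mulnb natrM.
Qed.

Lemma slice_mass_const1 (T U V : finType) (G : {set T * U}) (H : {set V}) :
  slice_mass (fun _ _ _ => 1) G H = #|G|%:R * #|H|%:R :> R.
Proof.
rewrite -!sum_indicator mulr_suml.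
transitivity (\sum_t \sum_u ((t, u) \in G)%:R * \sum_v (v \in H)%:R : R).
  do 2!apply: eq_bigr => ? _; rewrite mulr_sumr; apply: eq_bigr => ? _.
  by rewrite mul1r.
by rewrite pair_bigA; apply: eq_bigr => -[].
Qed.

Lemma dens_slice_xy G H : dens (slice_xy G H) = dens G * dens H :> R.
Proof.
have /= E := sum_slice_xy (fun _ _ _ => 1) G H.
rewrite slice_mass_const1 -mulr_sumr mul1r sum_indicator in E.
rewrite /dens E.
by rewrite !card_prod !natrM !invfM; ring.
Qed.

Lemma dens_slice_xz G H : dens (slice_xz G H) = dens G * dens H :> R.
Proof.
have /= E := sum_slice_xz (fun _ _ _ => 1) G H.
rewrite slice_mass_const1 -mulr_sumr mul1r sum_indicator in E.
rewrite /dens E.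
by rewrite !card_prod !natrM !invfM; ring.
Qed.

Lemma dens_slice_yz G H : dens (slice_yz G H) = dens G * dens H :> R.
Proof.
have /= E := sum_slice_yz (fun _ _ _ => 1) G H.
rewrite slice_mass_const1 -mulr_sumr mul1r sum_indicator in E.
rewrite /dens E.
by rewrite !card_prod !natrM !invfM; ring.
Qed.

Lemma is_slice_function s : is_slice s -> slice_function (fun w => (w \in s)%:R : R).
Proof.
case=> -[G [H ->]].
- apply: Or31; exists (fun x y => (x, y) \in G), (fun z => z \in H) => x y z.
  by rewrite inE -mulnb natrM.
- apply: Or33; exists (fun x z => (x, z) \in G), (fun y => y \in H) => x y z.
  by rewrite inE -mulnb natrM.
- apply: Or32; exists (fun x => x \in H), (fun y z => (y, z) \in G) => x y z.
  by rewrite inE -mulnb natrM mulrC.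
Qed.

Lemma expectation_indicator s : expectation (fun w => (w \in s)%:R : R) = dens s.
Proof. by rewrite /expectation sum_indicator. Qed.

(** All coefficients are 1/M; repetitions in [l] carry the weights. *)
Lemma slice_cover_functions (F : X * Y * Z -> R) (P : pred (X * Y * Z))
    (l : seq {set X * Y * Z}) (M : nat) (sigma e : R) :
  (forall w, F w = (P w)%:R) -> (0 < M)%N ->
  (forall s, s \in l -> is_slice s /\ sigma <= dens s) ->
  (forall w, P w -> (M <= count (fun s : {set X * Y * Z} => w \in s) l)%N) ->
  \sum_(s <- l) dens s <= e * M%:R ->
  exists (n : nat) (s : 'I_n -> X * Y * Z -> R) (a : 'I_n -> R),
    (forall i, slice_function (s i)) /\ (forall i, 0 <= a i) /\
    (forall w, F w <= \sum_(i < n) a i * s i w) /\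
    (forall i, sigma <= expectation (s i)) /\
    expectation (fun w => \sum_(i < n) a i * s i w) <= e.
Proof.
move=> FP M0 lS cov mass; have M0' : (0 : R) < M%:R by rewrite ltr0n.
exists (size l), (fun i w => (w \in tnth (in_tuple l) i)%:R), (fun=> M%:R^-1).
have sumE w : \sum_(i < size l) M%:R^-1 * (w \in tnth (in_tuple l) i)%:R =
    (count (fun s : {set X * Y * Z} => w \in s) l)%:R / M%:R :> R.
  rewrite -mulr_sumr mulrC; congr (_ / _).
  rewrite -sum1_count natr_sum.
  rewrite [RHS]big_mkcond big_tnth /=.
  by apply: eq_bigr => i _; case: (w \in _).
have tl i : tnth (in_tuple l) i \in l := mem_tnth i (in_tuple l).
split; first by move=> i; apply: is_slice_function; case: (lS _ (tl i)).
split; first by move=> _; rewrite invr_ge0 ltW.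
split.
  move=> w; rewrite sumE FP ler_pdivlMr //; case: (boolP (P w)) => [Pw|_].
    by rewrite mul1r ler_nat cov.
  by rewrite mul0r.
split; first by move=> i; rewrite expectation_indicator; case: (lS _ (tl i)).
have -> : expectation (fun w => \sum_(i < size l) M%:R^-1 * (w \in tnth (in_tuple l) i)%:R)
    = (\sum_(s <- l) dens s) / M%:R :> R.
  rewrite /expectation exchange_big /= [in RHS]big_tnth [LHS]mulr_suml [RHS]mulr_suml.
  apply: eq_bigr => i _; rewrite -mulr_sumr sum_indicator /dens; ring.
by rewrite ler_pdivrMr.
Qed.
End Slices.

(** * Covers of cylinder intersections *)

Definition cylinder_pred (X Y Z : finType) (f : X -> Y -> bool) (g : X -> Z -> bool)
    (h : Y -> Z -> bool) : pred (X * Y * Z) :=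
  fun w => [&& f w.1.1 w.1.2, g w.1.1 w.2 & h w.1.2 w.2].

Lemma cylinder_intersectionE {R : realType} (X Y Z : finType)
    (f : X -> Y -> bool) (g : X -> Z -> bool) (h : Y -> Z -> bool) w :
  cylinder_intersection R f g h w = (cylinder_pred f g h w)%:R.
Proof.
by case: w => -[x y] z; rewrite /cylinder_pred /= -!mulnb !natrM mulrA.
Qed.

(** If no admissible slice were heavy for [nu], [slice_mass_le_padded] with s = r0^2 would provide
    the hypotheses of [spread_measure_dense], against sparsity. The threshold r0^4 is this s^2. *)
Lemma sparse_cylinder_cover {R : realType} (X Y Z : finType)
    (f : X -> Y -> bool) (g : X -> Z -> bool) (h : Y -> Z -> bool) (p : nat)
    (n := (20 * 100 * p)%N) (r0 := (2 ^+ (n * p + 24 * (13 * p + 1) * p))^-1 : R) :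
  (24 <= p)%N -> ~~ odd p -> (0 < #|X|)%N -> (0 < #|Y|)%N -> (0 < #|Z|)%N ->
  expectation (cylinder_intersection R f g h) < (2 ^+ (3 * (n * p) + 3 * p))^-1 ->
  exists (l : seq {set X * Y * Z}) (M : nat),
    [/\ (0 < M)%N, forall s, s \in l -> is_slice s /\ r0 ^+ 4 <= dens s,
        forall w, cylinder_pred f g h w ->
          (M <= count (fun s : {set X * Y * Z} => w \in s) l)%N &
        \sum_(s <- l) dens s <= 4 / (2 ^+ p / 400) * M%:R :> R].
Proof.
move=> p24 pE X0 Y0 Z0 small.
have r00 : 0 < r0 by rewrite invr_gt0 exprn_gt0.
have r01 : r0 <= 1 by rewrite invf_le1 ?exprn_gt0 // exprn_ege1 //; clear; lra.
have K0 : (0 : R) < 2 ^+ p / 400 by rewrite divr_gt0 // exprn_gt0.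
apply: (@fractional_cover R _ (cylinder_pred f g h)
  (fun s => is_slice s /\ r0 ^+ 4 <= dens s) _ (r0 ^+ 4) K0).
- by rewrite exprn_gt0.
- by move=> s [].
move=> nu nu0 nu1 supp; set S := (fun s => _).
have [//|no] := pselect (exists2 s, S s &
  2 ^+ p / 400 * dens s <= \sum_w nu w * (w \in s)%:R).
exfalso; have lt s : is_slice s -> r0 ^+ 4 <= dens s ->
    \sum_w nu w * (w \in s)%:R <= 2 ^+ p / 400 * dens s.
  by move=> s1 s2; rewrite leNgt; apply/negP => h1; apply: no; exists s => //; exact: ltW.
move: small; rewrite ltNge => /negP; apply.
pose nu' x y z := nu (x, y, z).
have nuE w : nu w = nu' w.1.1 w.1.2 w.2 by case: w => -[].
have r2 : 0 <= r0 ^+ 2 <= 1 by rewrite sqr_ge0 expr_le1 // ltW.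
have r4 : r0 ^+ 4 = (r0 ^+ 2) ^+ 2 by rewrite -exprM.
apply: (@spread_measure_dense R X Y Z f g h nu' p) => //.
- by move=> x y z; apply: nu0.
- by rewrite -nu1 -sum_tripleE; apply: eq_bigr => -[[x y] z].
- by move=> x y z h1; apply: supp.
- apply: slice_mass_le_padded => //; [exact: ltW | by move=> *; apply: nu0 | move=> G H].
  rewrite -r4 -dens_slice_xy -sum_slice_xy => h1.
  under eq_bigr do rewrite -nuE.
  by apply: lt => //; apply: Or31; exists G, H.
- apply: slice_mass_le_padded => //; [exact: ltW | by move=> *; apply: nu0 | move=> G H].
  rewrite -r4 -dens_slice_xz -(sum_slice_xz nu') => h1.
  under eq_bigr do rewrite -nuE.
  by apply: lt => //; apply: Or32; exists G, H.
- apply: slice_mass_le_padded => //; [exact: ltW | by move=> *; apply: nu0 | move=> G H].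
  rewrite -r4 -dens_slice_yz -(sum_slice_yz nu') => h1.
  under eq_bigr do rewrite -nuE.
  by apply: lt => //; apply: Or33; exists G, H.
Qed.

Lemma pad_set_quarter {R : realType} (T : finType) (G : {set T}) :
  (0 < #|G|)%N -> dens G <= 3 / 4 :> R ->
  exists2 G' : {set T}, G \subset G' & (1 / 4 : R) <= dens G' <= (3 / 4 : R).
Proof.
move=> G0 G34; have [le|lt] := leP (1 / 4 : R) (dens G).
  by exists G => //; rewrite le.
have q0 : (0 : R) <= 1 / 4 by lra.
have q1 : (1 / 4 : R) <= 1 by lra.
have [G' sub /andP[h1 h2]] := @pad_set R T G (1 / 4) G0 (introT andP (conj q0 q1)).
by exists G' => //; rewrite h1 /=; lra.
Qed.

(** For bounded [d] a constant saving is enough, and one slice gives it: if [f], [g], [h] all had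
    density above 3/4, the union bound on complements would give the intersection density above
    1/4. *)
Lemma cylinder_cover_quarter {R : realType} (X Y Z : finType)
    (f : X -> Y -> bool) (g : X -> Z -> bool) (h : Y -> Z -> bool) :
  (0 < #|X|)%N -> (0 < #|Y|)%N -> (0 < #|Z|)%N ->
  expectation (cylinder_intersection R f g h) < 1 / 4 ->
  exists (l : seq {set X * Y * Z}) (M : nat),
    [/\ (0 < M)%N, forall s, s \in l -> is_slice s /\ 1 / 4 <= dens s :> R,
        forall w, cylinder_pred f g h w ->
          (M <= count (fun s : {set X * Y * Z} => w \in s) l)%N &
        \sum_(s <- l) dens s <= 3 / 4 * M%:R :> R].
Proof.
move=> X0 Y0 Z0 small.
pose Gf := [set u : X * Y | f u.1 u.2]; pose Gg := [set u : X * Z | g u.1 u.2].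
pose Gh := [set u : Y * Z | h u.1 u.2].
suff [T [G [sl [dG [dsl1 dsl2]]]]] : exists (T : finType) (G : {set T})
    (sl : {set T} -> {set X * Y * Z}),
    dens G <= 3 / 4 :> R /\ (forall G', is_slice (sl G') /\ dens (sl G') = dens G' :> R) /\
    (forall w (G' : {set T}), cylinder_pred f g h w -> G \subset G' -> (0 < #|G|)%N /\ w \in sl G').
  have [/eqP|G0] := posnP #|G|.
    rewrite cards_eq0 => /eqP G0; exists [::], 1%N; split=> //.
      by move=> w /(dsl2 w G); rewrite subxx G0 cards0 => /(_ erefl)[].
    by rewrite big_nil mulr1; lra.
  have [G' sub /andP[h1 h2]] := pad_set_quarter G0 dG.
  exists [:: sl G'], 1%N; split=> //.
  - by move=> s; rewrite inE => /eqP->; have [isl ->] := dsl1 G'.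
  - by move=> w /(dsl2 w G')/(_ sub)[_ wG] /=; rewrite wG.
  - by rewrite big_seq1 mulr1; have [_ ->] := dsl1 G'.
have [dGf|dGf] := leP (dens Gf) (3 / 4 : R).
  exists _, Gf, (fun G => slice_xy G setT); split=> //; split.
    move=> G'; rewrite dens_slice_xy densT // mulr1; split=> //.
    by apply: Or31; exists G', setT.
  move=> w G' /and3P[fw _ _] /subsetP sub.
  have wG : w.1 \in Gf by rewrite inE.
  by rewrite !inE sub // andbT; split=> //; apply/card_gt0P; exists w.1.
have [dGg|dGg] := leP (dens Gg) (3 / 4 : R).
  exists _, Gg, (fun G => slice_xz G setT); split=> //; split.
    move=> G'; rewrite dens_slice_xz densT // mulr1; split=> //.
    by apply: Or32; exists G', setT.
  move=> w G' /and3P[_ gw _] /subsetP sub.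
  have wG : (w.1.1, w.2) \in Gg by rewrite inE.
  by rewrite !inE sub // andbT; split=> //; apply/card_gt0P; exists (w.1.1, w.2).
have [dGh|dGh] := leP (dens Gh) (3 / 4 : R).
  exists _, Gh, (fun G => slice_yz G setT); split=> //; split.
    move=> G'; rewrite dens_slice_yz densT // mulr1; split=> //.
    by apply: Or33; exists G', setT.
  move=> w G' /and3P[_ _ hw] /subsetP sub.
  have wG : (w.1.2, w.2) \in Gh by rewrite inE.
  by rewrite !inE sub // andbT; split=> //; apply/card_gt0P; exists (w.1.2, w.2).
exfalso.
have dE : dens (slice_xy Gf [set: Z]) + dens (slice_xz Gg [set: Y]) +
    dens (slice_yz Gh [set: X]) - 2 <= expectation (cylinder_intersection R f g h).
  have T0 : (0 < #|{: X * Y * Z}|)%N by rewrite !card_prod !muln_gt0 X0 Y0 Z0.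
  have T0' : (0 : R) < #|{: X * Y * Z}|%:R by rewrite ltr0n.
  rewrite -!(@expectation_indicator R) /expectation ler_pdivlMr //.
  rewrite mulrBl mulrDl mulrDl !divfK ?gt_eqF //.
  have -> : 2 * #|{: X * Y * Z}|%:R = \sum_(w : X * Y * Z) 2 :> R.
    by rewrite sumr_const mulr_natr.
  rewrite -!big_split -sumrB; apply: ler_sum => w _ /=.
  rewrite cylinder_intersectionE /cylinder_pred !inE !andbT /=.
  by case: (f _ _); case: (g _ _); case: (h _ _); clear; rewrite /=; lra.
rewrite dens_slice_xy dens_slice_xz dens_slice_yz !densT // !mulr1 in dE.
by clear -dE dGf dGg dGh small; lra.
Qed.

(** * Choice of the scale and conclusion *)

Lemma powR2N_le {R : realType} (m : nat) (x : R) :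
  m%:R <= x -> 2 `^ (- x) <= (2 ^+ m)^-1.
Proof.
move=> mx; rewrite -powR_invn //; apply: ler_powR; first by lra.
by rewrite lerN2.
Qed.

Lemma powR2N_ge {R : realType} (m : nat) (x : R) :
  x <= m%:R -> (2 ^+ m)^-1 <= 2 `^ (- x).
Proof.
move=> mx; rewrite -powR_invn //; apply: ler_powR; first by lra.
by rewrite lerN2.
Qed.

Lemma powR2N_ge1B {R : realType} (x : R) : 0 <= x -> 1 - x <= 2 `^ (- x).
Proof.
move=> x0; rewrite /powR pnatr_eq0 /=.
have ln2 : ln (2 : R) <= 1.
  by rewrite -[leRHS]expRK ler_ln ?posrE ?expR_gt0 //; have := expR_ge1Dx (1 : R); lra.
apply: le_trans (expR_ge1Dx _); rewrite mulNr.
have : x * ln 2 <= x * 1 by rewrite ler_wpM2l.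
lra.
Qed.

(** The largest even [p] with 7000 p^2 <= d; maximality gives d < 7000 (p + 2)^2. The 7000 dominates
    the exponent 6000 p^2 + 3 p + 1 needed for sparsity. *)
Lemma exists_even_scale {R : realType} (d : R) : 7 * 1000 * 24 ^+ 2 <= d ->
  exists p : nat, [/\ (24 <= p)%N, ~~ odd p, 7 * 1000 * p%:R ^+ 2 <= d &
    Num.sqrt d <= 100 * (p%:R + 2)].
Proof.
move=> d_big; pose Q (k : nat) := 7 * 1000 * (2 * k)%:R ^+ 2 <= d.
have Q12 : Q 12 by rewrite /Q (_ : (2 * 12)%:R = 24 :> R).
have Qbound k : Q k -> (k <= Num.bound d)%N.
  rewrite /Q natrM => Qk; rewrite -(ler_nat R); apply: ltW.
  have d0 : 0 <= d by apply: le_trans d_big; rewrite expr2; lra.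
  apply: le_lt_trans (archi_boundP d0); apply: le_trans Qk.
  have k0 : (0 : R) <= k%:R by [].
  case: k k0 => [|k] k0; first by rewrite mulr_ge0 ?sqr_ge0 // mulr_ge0.
  have k1 : (1 : R) <= k.+1%:R by rewrite ler1n.
  have : k.+1%:R * 1 <= k.+1%:R * k.+1%:R :> R by rewrite ler_wpM2l.
  rewrite expr2; move: (k.+1%:R) k1 => x x1 xx; lra.
have [k Qk kmax] := ex_maxnP (ex_intro _ 12%N Q12) Qbound.
have k12 : (12 <= k)%N := kmax _ Q12.
exists (2 * k)%N; split.
- by clear -k12; lia.
- by rewrite oddM.
- exact: Qk.
have : ~~ Q k.+1 by apply/negP => /kmax; rewrite ltnn.
rewrite -ltNge; have -> : ((2 * k.+1)%:R : R) = (2 * k)%:R + 2.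
  by rewrite -natrD; congr (_%:R); clear; lia.
set y : R := _ + 2; have y0 : 0 <= y by rewrite addr_ge0.
move=> dy; rewrite -[leRHS]ger0_norm ?mulr_ge0 // -sqrtr_sqr ler_wsqrtr //.
apply: le_trans (ltW dy) _; have := sqr_ge0 y; rewrite exprMn.
move: (y ^+ 2) => u u0; clear -u0; rewrite expr2; lra.
Qed.

Theorem theorem4p1 (R : realType) :
  exists c C : R, 0 < c /\ 0 < C /\
    forall (X Y Z : finType),
      (0 < #|X|)%N -> (0 < #|Y|)%N -> (0 < #|Z|)%N ->
    forall (f : X -> Y -> bool) (g : X -> Z -> bool) (h : Y -> Z -> bool)
           (d : R),
      5 <= d ->
      expectation (cylinder_intersection R f g h) <= 2 `^ (- d) ->
      exists (n : nat) (s : 'I_n -> X * Y * Z -> R) (a : 'I_n -> R),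
        (forall i, slice_function (s i)) /\
        (forall i, 0 <= a i) /\
        (forall w : X * Y * Z,
           cylinder_intersection R f g h w <= \sum_(i < n) a i * s i w) /\
        (forall i, 2 `^ (- (C * d)) <= expectation (s i)) /\
        expectation (fun w : X * Y * Z => \sum_(i < n) a i * s i w)
          <= 2 `^ (- (c * Num.sqrt d)).
Proof.
(* C = 2 suffices because r0^4 has exponent 9248 p^2 + 96 p <= 14000 p^2. In the bounded range sqrt
   d <= 2400, and c = 1/10000 gives 1 - c sqrt d >= 3/4. *)
exists (1 / (1000 * 10)), 2; split; first by lra.
split; first by lra.
move=> X Y Z X0 Y0 Z0 f g h d d5 Fd.
have cE := @cylinder_intersectionE R X Y Z f g h.
have [d_small|d_big] := ltP d (7 * 1000 * 24 ^+ 2).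
  have small : expectation (cylinder_intersection R f g h) < 1 / 4.
    apply: le_lt_trans Fd _; apply: le_lt_trans (powR2N_le (_ : 5%:R <= d)) _ => //.
    by rewrite !exprS expr0; clear; lra.
  have [l [M [M0 lS cov mass]]] := cylinder_cover_quarter X0 Y0 Z0 small.
  apply: (slice_cover_functions cE M0 _ cov).
    move=> s /lS[isl ds]; split=> //; apply: le_trans ds.
    apply: le_trans (powR2N_le (_ : 2%:R <= 2 * d)) _; first by clear -d5; lra.
    by rewrite !exprS expr0; clear; lra.
  apply: le_trans mass _; rewrite ler_wpM2r //.
  have sq : Num.sqrt d <= 100 * 24.
    have h0 : (0 : R) <= 100 * 24 by clear; lra.
    rewrite -[leRHS]ger0_norm // -sqrtr_sqr ler_wsqrtr //.
    by apply: le_trans (ltW d_small) _; rewrite !expr2; clear; lra.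
  have sq0 := sqrtr_ge0 d.
  apply: le_trans (powR2N_ge1B _); last by rewrite mulr_ge0 //; clear; lra.
  by clear -sq; lra.
have [p [p24 pE pd sqd]] := exists_even_scale d_big.
have p24' : (24 : R) <= p%:R by rewrite (ler_nat R 24 p).
have pp : 24 * p%:R <= p%:R ^+ 2 :> R by rewrite expr2 ler_wpM2r.
have small : expectation (cylinder_intersection R f g h) <
    (2 ^+ (3 * (20 * 100 * p * p) + 3 * p))^-1.
  apply: le_lt_trans Fd _.
  apply: le_lt_trans (powR2N_le (_ : (3 * (20 * 100 * p * p) + 3 * p).+1%:R <= d)) _.
    rewrite -natr1 natrD !natrM -mulrA -[p%:R * p%:R]expr2.
    by clear -pd pp p24'; move: (p%:R ^+ 2) pd pp => u *; lra.
  rewrite ltf_pV2 ?posrE ?exprn_gt0 // exprS ltr_pMl ?exprn_gt0 //.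
  by clear; lra.
have [l [M [M0 lS cov mass]]] := sparse_cylinder_cover p24 pE X0 Y0 Z0 small.
apply: (slice_cover_functions cE M0 _ cov).
  move=> s /lS[isl ds]; split=> //; apply: le_trans ds.
  rewrite exprVn -exprM; apply: powR2N_le.
  rewrite natrM natrD !natrM natrD natrM.
  clear -pd pp p24'; rewrite expr2 in pd pp.
  by move: (p%:R) pd pp p24' => u *; lra.
apply: le_trans mass _; rewrite ler_wpM2r //.
(* The cover costs 1600 / 2^p, and 1600 <= 2^11. *)
have c0 : 1 / (1000 * 10) * Num.sqrt d <= (p - 11)%:R.
  rewrite natrB; last by clear -p24; lia.
  by clear -sqd p24'; lra.
apply: le_trans (powR2N_ge c0).
have pE11 : (2 : R) ^+ p = 2 ^+ (p - 11) * 2 ^+ 11.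
  by rewrite -exprD subnK //; clear -p24; lia.
have u0 : (0 : R) < 2 ^+ (p - 11) by rewrite exprn_gt0.
rewrite -[leRHS]div1r ler_pdivlMr //.
have -> : 4 / (2 ^+ p / 400) * 2 ^+ (p - 11) = 4 * 400 / 2 ^+ 11 :> R.
  rewrite pE11; field.
  by rewrite gt_eqF.
by rewrite ler_pdivrMr ?exprn_gt0 // !exprS expr0; clear; lra.
Qed.
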